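(* (ZF + DC + $\mathrm{AC}_{\mathcal P(Y)}$) Let $\bar\alpha=\langle\alpha_t:t\in Y\rangle\in{}^Y\mathrm{Ord}$ with $\mathrm{cf}(\alpha_t)\ge\theta(\mathcal P(Y))$ for every $t\in Y$, and let $\partial\in\text{ps-pcf}_{\aleph_1\text{-comp}}(\bar\alpha)$ (hence $\partial$ is a regular cardinal). Then there is an $\aleph_1$-complete filter $D=D^{\bar\alpha}_\partial$ on $Y$ such that $\partial=\text{ps-tcf}(\prod\bar\alpha,<_D)$ and $D\subseteq D'$ for every other $\aleph_1$-complete filter $D'$ on $Y$ with $\partial=\text{ps-tcf}(\prod\bar\alpha,<_{D'})$.
   Context: The base theory is ZF. $\mathrm{AC}_X$ says that every family of non-empty sets indexed by $X$ has a choice function. Filters are proper; a filter is $\aleph_1$-complete if it is closed under countable intersections. For a set $A$, $\theta(A)$ is the least (non-zero) ordinal $\alpha$ such that there is no function from $A$ onto $\alpha$. For a filter $D$ on $Y$ and $f,g:Y\to\mathrm{Ord}$, $f<_D g$ means $\{s\in Y:f(s)<g(s)\}\in D$. Pseudo true cofinality: for a filter $D$ on $Y$ and $\bar\alpha\in{}^Y\mathrm{Ord}$, $(\prod\bar\alpha,<_D)$ has pseudo true cofinality $\gamma$ when $\gamma$ is a limit ordinal and there is a sequence $\langle\mathcal F_\beta:\beta<\gamma\rangle$ such that: each $\mathcal F_\beta$ is a non-empty subset of $\{f\in{}^Y\mathrm{Ord}:f<_D\bar\alpha\}$; if $\beta_1<\beta_2<\gamma$, $f_1\in\mathcal F_{\beta_1}$,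 $f_2\in\mathcal F_{\beta_2}$ then $f_1<_D f_2$; and if $f\in{}^Y\mathrm{Ord}$, $f<_D\bar\alpha$, then for some $\beta<\gamma$ we have $f<_D g$ for all $g\in\mathcal F_\beta$. If such $\gamma$ exists, $\text{ps-tcf}(\prod\bar\alpha,<_D)$ denotes the minimal one. $\text{ps-pcf}_{\aleph_1\text{-comp}}(\bar\alpha)$ is the set of all $\gamma$ such that for some $\aleph_1$-complete filter $D$ on $Y$, $(\prod\bar\alpha,<_D)$ has pseudo true cofinality $\gamma$ and $\gamma$ is minimal for $D$. *)

(* Defs.v *)
(** The base theory is ZF, so the mathematics takes place inside an arbitrary
    first-order model [M] of ZF: a "set" is an element of [M], and Rocq's own
    functions and predicates play no role except as the metatheory.  By
    completeness, truth in all such models is provability in the theory.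
    Choice in the metatheory does not make choice hold in [M], because
    Separation and Replacement are required only for first-order formulas. *)

Record SetStructure : Type := {
  carrier :> Type;
  mem : carrier -> carrier -> Prop
}.

Arguments mem {_} _ _.

Notation "x ∈ y" := (mem x y) (at level 70, no associativity).

(** First-order formulas in the language of set theory, with de Bruijn indices. *)
Inductive formula : Type :=
| fMem (i j : nat)
| fEq (i j : nat)
| fBot
| fAnd (p q : formula)
| fOr (p q : formula)
| fImp (p q : formula)
| fEx (p : formula)
| fAll (p : formula).

Definition scons {T : Type} (x : T) (e : nat -> T) (n : nat) : T :=
  match n with
  | O => x
  | S k => e k
  end.

Fixpoint sat {M : SetStructure} (e : nat -> M) (p : formula) : Prop :=
  match p with
  | fMem i j => e i ∈ e j
  | fEq i j => e i = e j
  | fBot => False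
  | fAnd p q => sat e p /\ sat e q
  | fOr p q => sat e p \/ sat e q
  | fImp p q => sat e p -> sat e q
  | fEx p => exists x : M, sat (scons x e) p
  | fAll p => forall x : M, sat (scons x e) p
  end.

Section InModel.

Context {M : SetStructure}.
Implicit Types a b c f g p s t w x y z A B D F R S X Y Z : M.

Definition subset x y : Prop := forall z, z ∈ x -> z ∈ y.

Definition nonempty x : Prop := exists y, y ∈ x.

Definition is_empty x : Prop := forall y, ~ y ∈ x.

Definition is_upair z x y : Prop := forall w, w ∈ z <-> w = x \/ w = y.

Definition is_powerset z x : Prop := forall w, w ∈ z <-> subset w x.

Definition is_succ z x : Prop := forall w, w ∈ z <-> w ∈ x \/ w = x.

(** In the two schemas, the environment [e] supplies the parameters; variable
    [0] of [p] is the element (resp. the value), and, in Replacement,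
    variable [1] is the argument. *)
Record ZF : Prop := {
  zf_extensionality : forall x y, (forall z, z ∈ x <-> z ∈ y) -> x = y;
  zf_foundation : forall x, nonempty x -> exists y, y ∈ x /\ forall z, z ∈ y -> ~ z ∈ x;
  zf_pairing : forall x y, exists z, is_upair z x y;
  zf_union : forall x, exists u : M, forall z, z ∈ u <-> exists y, y ∈ x /\ z ∈ y;
  zf_powerset : forall x, exists z, is_powerset z x;
  zf_infinity : exists w,
    (exists x, x ∈ w /\ is_empty x) /\
    (forall x, x ∈ w -> exists y, y ∈ w /\ is_succ y x);
  zf_separation : forall (p : formula) (e : nat -> M) x,
    exists z, forall y, y ∈ z <-> y ∈ x /\ sat (scons y e) p;
  zf_replacement : forall (p : formula) (e : nat -> M) x,
    (forall y, y ∈ x -> forall z z' : M,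
       sat (scons z (scons y e)) p -> sat (scons z' (scons y e)) p -> z = z') ->
    exists w, forall z, z ∈ w <-> exists y, y ∈ x /\ sat (scons z (scons y e)) p
}.

(** Kuratowski pairs. *)
Definition is_opair p x y : Prop :=
  exists a b, is_upair a x x /\ is_upair b x y /\ is_upair p a b.

(** [(x, y) ∈ f]; when [f] is a function, [f(x) = y]. *)
Definition app f x y : Prop := exists p, is_opair p x y /\ p ∈ f.

Definition is_fun f X : Prop :=
  (forall p, p ∈ f -> exists x y, x ∈ X /\ is_opair p x y) /\
  (forall x, x ∈ X -> exists! y, app f x y).

Definition maps_to f X Z : Prop :=
  is_fun f X /\ forall x y, x ∈ X -> app f x y -> y ∈ Z.

Definition is_onto f X Z : Prop :=
  maps_to f X Z /\ forall z, z ∈ Z -> exists x, x ∈ X /\ app f x z.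

Definition is_bijection f X Z : Prop :=
  is_onto f X Z /\
  forall x x' z : M, x ∈ X -> x' ∈ X -> app f x z -> app f x' z -> x = x'.

(** Von Neumann ordinals; well-foundedness of [∈] is the Foundation axiom. *)
Definition is_ordinal a : Prop :=
  (forall x, x ∈ a -> subset x a) /\
  (forall x y, x ∈ a -> y ∈ a -> x ∈ y \/ x = y \/ y ∈ x).

Definition ord_le a b : Prop := a ∈ b \/ a = b.

Definition is_least_ordinal (P : M -> Prop) a : Prop :=
  is_ordinal a /\ P a /\ forall b, is_ordinal b -> P b -> ord_le a b.

Definition is_limit a : Prop :=
  is_ordinal a /\ nonempty a /\ forall x, x ∈ a -> exists y, y ∈ a /\ x ∈ y.

Definition is_omega w : Prop := is_least_ordinal is_limit w.

Definition is_theta A a : Prop :=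
  is_least_ordinal (fun b => nonempty b /\ ~ exists f, is_onto f A b) a.

(** [c = cf(a)]; thus [cf(0) = 0] and the cofinality of a successor is [1]. *)
Definition is_cf a c : Prop :=
  is_least_ordinal
    (fun b => exists f, maps_to f b a /\
       forall x, x ∈ a -> exists i y : M, i ∈ b /\ app f i y /\ ord_le x y) c.

Definition is_cardinal a : Prop :=
  is_ordinal a /\ forall b, b ∈ a -> ~ exists f, is_bijection f b a.

Definition is_regular_cardinal a : Prop :=
  is_cardinal a /\ is_limit a /\ is_cf a a.

Definition DC : Prop :=
  forall A R,
    nonempty A ->
    (forall x, x ∈ A -> exists y, y ∈ A /\ app R x y) ->
    exists w f, is_omega w /\ maps_to f w A /\
      forall n m x y : M,
        n ∈ w -> is_succ m n -> app f n x -> app f m y -> app R x y.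

Definition AC_on X : Prop :=
  forall F,
    is_fun F X ->
    (forall x A, x ∈ X -> app F x A -> nonempty A) ->
    exists c, is_fun c X /\
      forall x A y, x ∈ X -> app F x A -> app c x y -> y ∈ A.

Definition is_filter D Y : Prop :=
  (forall A, A ∈ D -> subset A Y) /\
  Y ∈ D /\
  (forall A, A ∈ D -> ~ is_empty A) /\
  (forall A B, A ∈ D -> subset A B -> subset B Y -> B ∈ D) /\
  (forall A B C : M,
     A ∈ D -> B ∈ D -> (forall t, t ∈ C <-> t ∈ A /\ t ∈ B) -> C ∈ D).

Definition is_aleph1_complete_filter D Y : Prop :=
  is_filter D Y /\
  forall w s B,
    is_omega w -> maps_to s w D ->
    (forall t, t ∈ B <-> t ∈ Y /\ forall n A, n ∈ w -> app s n A -> t ∈ A) ->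
    B ∈ D.

(** [f ∈ ^Y Ord]. *)
Definition ord_fun f Y : Prop :=
  is_fun f Y /\ forall t a, t ∈ Y -> app f t a -> is_ordinal a.

(** [f <_D g]. *)
Definition lt_mod Y D f g : Prop :=
  exists B, B ∈ D /\
    forall t, t ∈ B <-> t ∈ Y /\ exists a b, app f t a /\ app g t b /\ a ∈ b.

(** [F] is the sequence [<F_i : i < c>] witnessing that [(∏ alpha, <_D)] has
    pseudo true cofinality [c]. *)
Definition has_pseudo_tcf Y alpha D c : Prop :=
  is_limit c /\
  exists F, is_fun F c /\
    (forall i S : M, i ∈ c -> app F i S ->
       nonempty S /\ forall f, f ∈ S -> ord_fun f Y /\ lt_mod Y D f alpha) /\
    (forall i j S T f g : M,
       i ∈ j -> j ∈ c -> app F i S -> app F j T -> f ∈ S -> g ∈ T ->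
       lt_mod Y D f g) /\
    (forall f, ord_fun f Y -> lt_mod Y D f alpha ->
       exists i S : M, i ∈ c /\ app F i S /\ forall g, g ∈ S -> lt_mod Y D f g).

Definition is_ps_tcf Y alpha D c : Prop :=
  is_least_ordinal (has_pseudo_tcf Y alpha D) c.

Definition in_ps_pcf_aleph1_comp Y alpha c : Prop :=
  exists D, is_aleph1_complete_filter D Y /\ is_ps_tcf Y alpha D c.

End InModel.

Arguments ZF : clear implicits.
Arguments DC : clear implicits.

(* Main.v *)
Require Import Defs.
From Stdlib Require Import Classical ClassicalEpsilon PeanoNat.

(** Call an aleph1-complete filter on [Y] realizing when its pseudo true
    cofinality is [d].  The required filter is the intersection [D] of all
    realizing filters.  It is an aleph1-complete filter contained in each of
    them, so the point is that the product of [alpha] has pseudo true cofinality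
    [d] modulo [D].

    A set [B] outside [D] is omitted by some realizing filter [D_B], and choice
    over the power set of [Y] selects these filters together with sequences
    [<F^B_i : i < d>] witnessing their cofinality; then [D] is the intersection
    of the [D_B], a family indexed by the power set.  Two facts make families of
    that size harmless.  Since every [cf(alpha_t)] is at least theta of the power
    set, such a family of functions in the product has a strict pointwise bound
    in the product ([small_set_bounded], [family_bounded]).  Consequently such a
    family of ordinals below [d] is bounded below [d] ([scale_index_bounded]): a
    bound for chosen members of the corresponding levels of a witness lies below
    some level.

    Say that [f] is above [b] when, for every [B], it lies modulo [D_B] above all
    levels of [F^B] with index less than [b], and that [f] is below [j] when, for
    every [B], it lies modulo [D_B] below level [j].  By choice and the first
    fact some [f] is above [b]; by the second fact every [f] is below some
    [j < d].  Taking for the new level [b] all the bounds that choice can produce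
    would not work, because nothing bounds them simultaneously.  So let [h(b)] be
    the least [j > b] such that some [f] is both above [b] and below [j], and let
    the new level [b] consist of all such [f].  Level [b] then precedes level [c]
    modulo every [D_B], hence modulo [D], as soon as [h(b) < c].  Passing to the
    indices [s(i) = sup {h(s(j)) + 1 : j < i}] ([thinning]) gives a witness
    modulo [D] of some limit length [a <= d] ([scale_intersection]).  A witness
    modulo [D] is one modulo any realizing filter, so minimality of [d] gives
    [a = d].  Thinning also yields the regularity of [d] ([ps_tcf_regular]): a
    short cofinal map would produce a shorter witness.

    Inside a first-order model, Separation and Replacement apply only to
    formulas.  All sets above are therefore formed from predicates and terms
    known to be definable; the first part closes definability under the logical
    connectives and under definite descriptions, which makes it automatic. *)

Section Model.

(** * Definability *)

Context {M : SetStructure}.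
Implicit Types P Q : (nat -> M) -> Prop.

Definition lift (r : nat -> nat) (n : nat) : nat :=
  match n with O => O | S k => S (r k) end.

Fixpoint rename (r : nat -> nat) (p : formula) : formula :=
  match p with
  | fMem i j => fMem (r i) (r j)
  | fEq i j => fEq (r i) (r j)
  | fBot => fBot
  | fAnd p q => fAnd (rename r p) (rename r q)
  | fOr p q => fOr (rename r p) (rename r q)
  | fImp p q => fImp (rename r p) (rename r q)
  | fEx p => fEx (rename (lift r) p)
  | fAll p => fAll (rename (lift r) p)
  end.

Lemma sat_rename p : forall (r : nat -> nat) (e e' : nat -> M),
  (forall n, e' n = e (r n)) -> (sat e (rename r p) <-> sat e' p).
Proof.
  induction p; intros r e e' E; simpl; rewrite ?E; try tauto;
    try (rewrite (IHp1 r e e' E), (IHp2 r e e' E); tauto).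
  - assert (H : forall x, sat (scons x e) (rename (lift r) p) <-> sat (scons x e') p)
      by (intro x; apply IHp; intros [|n]; simpl; auto).
    split; intros [x Hx]; exists x; apply H, Hx.
  - assert (H : forall x, sat (scons x e) (rename (lift r) p) <-> sat (scons x e') p)
      by (intro x; apply IHp; intros [|n]; simpl; auto).
    split; intros Hx x; apply H, Hx.
Qed.

(** The table [r] says of each variable of a formula whether it stands for a
    place of the environment or for a parameter. *)
Definition lookup (r : nat -> nat + M) (e : nat -> M) (n : nat) : M :=
  match r n with inl i => e i | inr c => c end.

Definition definable P : Prop :=
  exists p r, forall e, P e <-> sat (lookup r e) p.

(** Variable [0] is the value, and the remaining variables are the arguments. *)
Definition definable_term (u : (nat -> M) -> M) : Prop :=
  definable (fun e => e 0 = u (fun n => e (S n))).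

Lemma definable_equiv P Q : (forall e, P e <-> Q e) -> definable Q -> definable P.
Proof.
  intros E (p & r & H); exists p, r; intro e; rewrite E; apply H.
Qed.

(** Two formulas keep their own parameters: the variables of the first are moved
    to even places of a common table, those of the second to odd places. *)
Lemma definable_merge P Q : definable P -> definable Q ->
  exists p q r, forall e, (P e <-> sat (lookup r e) p) /\ (Q e <-> sat (lookup r e) q).
Proof.
  intros (p & r1 & Hp) (q & r2 & Hq).
  exists (rename (fun n => 2 * n) p), (rename (fun n => S (2 * n)) q),
    (fun n => if Nat.even n then r1 (Nat.div2 n) else r2 (Nat.div2 n)).
  intro e; rewrite Hp, Hq; split; symmetry; apply sat_rename; intro n; unfold lookup.
  - rewrite Nat.even_even, Nat.div2_double; reflexivity.
  - rewrite <- Nat.add_1_r at 1.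
    rewrite Nat.even_odd, Nat.div2_succ_double; reflexivity.
Qed.

Lemma definable_and P Q : definable P -> definable Q -> definable (fun e => P e /\ Q e).
Proof.
  intros HP HQ; destruct (definable_merge _ _ HP HQ) as (p & q & r & H).
  exists (fAnd p q), r; intro e; destruct (H e); simpl; tauto.
Qed.

Lemma definable_or P Q : definable P -> definable Q -> definable (fun e => P e \/ Q e).
Proof.
  intros HP HQ; destruct (definable_merge _ _ HP HQ) as (p & q & r & H).
  exists (fOr p q), r; intro e; destruct (H e); simpl; tauto.
Qed.

Lemma definable_imp P Q : definable P -> definable Q -> definable (fun e => P e -> Q e).
Proof.
  intros HP HQ; destruct (definable_merge _ _ HP HQ) as (p & q & r & H).
  exists (fImp p q), r; intro e; destruct (H e); simpl; tauto.
Qed.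

(** A proposition that does not mention the environment is true or false, and
    both truth values are expressed by formulas. *)
Lemma definable_const (A : Prop) : definable (fun _ => A).
Proof.
  destruct (classic A) as [H | H].
  - exists (fImp fBot fBot), inl; simpl; tauto.
  - exists fBot, inl; simpl; tauto.
Qed.

(** Every occurrence of place [0] of the environment is gathered into variable
    [0] of the formula, where a quantifier, or Separation, can bind it. *)
Lemma definable_bind P : definable P ->
  exists p r, forall x e, P (scons x e) <-> sat (scons x (lookup r e)) p.
Proof.
  intros (p & r & H).
  exists (rename (fun n => match r n with inl O => O | _ => S n end) p),
    (fun n => match r n with inl (S i) => inl i | a => a end).
  intros x e; rewrite H; symmetry; apply sat_rename; intro n; unfold lookup.
  destruct (r n) as [[|i]|c] eqn:E; simpl; rewrite ?E; reflexivity.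
Qed.

Lemma definable_ex (Q : M -> (nat -> M) -> Prop) :
  definable (fun e => Q (e 0) (fun n => e (S n))) -> definable (fun e => exists x, Q x e).
Proof.
  intro H; destruct (definable_bind _ H) as (p & r & E).
  exists (fEx p), r; intro e; simpl; split; intros [x Hx]; exists x; apply (E x e); exact Hx.
Qed.

Lemma definable_all (Q : M -> (nat -> M) -> Prop) :
  definable (fun e => Q (e 0) (fun n => e (S n))) -> definable (fun e => forall x, Q x e).
Proof.
  intro H; destruct (definable_bind _ H) as (p & r & E).
  exists (fAll p), r; intro e; simpl; split; intros Hx x; apply (E x e), Hx.
Qed.

Lemma definable_rename P (s : nat -> nat) :
  definable P -> definable (fun e => P (fun n => e (s n))).
Proof.
  intros (p & r & H).
  exists p, (fun n => match r n with inl i => inl (s i) | inr c => inr c end).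
  intro e; rewrite H.
  assert (E : forall n, lookup r (fun n => e (s n)) n =
     lookup (fun n => match r n with inl i => inl (s i) | inr c => inr c end) e (id n))
    by (intro n; unfold lookup, id; destruct (r n); reflexivity).
  rewrite <- (sat_rename p _ _ _ E).
  apply sat_rename; reflexivity.
Qed.

Lemma term_rename (u : (nat -> M) -> M) (s : nat -> nat) :
  definable_term u -> definable_term (fun e => u (fun n => e (s n))).
Proof.
  exact (definable_rename (fun e => e 0 = u (fun n => e (S n))) (lift s)).
Qed.

Lemma term_var i : definable_term (fun e => e i).
Proof.
  exists (fEq 0 (S i)), inl; intro e; simpl; reflexivity.
Qed.

Lemma term_const (c : M) : definable_term (fun _ => c).
Proof.
  exists (fEq 0 1), (fun n => match n with O => inl 0 | _ => inr c end).
  intro e; simpl; reflexivity.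
Qed.

Lemma definable_eq (u v : (nat -> M) -> M) :
  definable_term u -> definable_term v -> definable (fun e => u e = v e).
Proof.
  intros Hu Hv.
  apply (definable_equiv _ (fun e => exists x, x = u e /\ x = v e)).
  - intro e; split; [intro E; exists (u e) | intros (x & <- & <-)]; auto.
  - apply definable_ex, definable_and; assumption.
Qed.

(** A term is available only through its graph, so the two values have to be
    quantified. *)
Lemma definable_mem (u v : (nat -> M) -> M) :
  definable_term u -> definable_term v -> definable (fun e => u e ∈ v e).
Proof.
  intros Hu Hv.
  apply (definable_equiv _ (fun e => exists x, x = u e /\ exists y, y = v e /\ x ∈ y)).
  - intro e; split.
    + intro E; exists (u e); split; [reflexivity | exists (v e)]; auto.
    + intros (x & -> & y & -> & E); exact E.
  - apply definable_ex, definable_and; [exact Hu |].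
    apply definable_ex, definable_and.
    + exact (term_rename v S Hv).
    + exists (fMem 1 0), inl; intro e; simpl; reflexivity.
Qed.

(** The form needed for Replacement, where the argument and the value are both
    bound; [m] only pads the environment. *)
Lemma definable_bind2 P (m : M) : definable P ->
  exists p e0, forall x y, P (scons x (scons y (fun _ => m))) <-> sat (scons x (scons y e0)) p.
Proof.
  intros (p & r & H).
  exists (rename (fun n => match r n with inl O => 0 | inl 1 => 1 | _ => S (S n) end) p),
    (fun n => match r n with inr c => c | _ => m end).
  intros x y; rewrite H; symmetry; apply sat_rename; intro n; unfold lookup.
  destruct (r n) as [[|[|i]]|c] eqn:E; simpl; rewrite ?E; reflexivity.
Qed.

Definition definable_pred (A : M -> Prop) : Prop := definable (fun e => A (e 0)).

Definition definable_rel (R : M -> M -> Prop) : Prop := definable (fun e => R (e 0) (e 1)).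

Definition definable_map (F : M -> M) : Prop := definable_term (fun e => F (e 0)).

Definition definable_map2 (F : M -> M -> M) : Prop := definable_term (fun e => F (e 0) (e 1)).

Lemma pred_term (A : M -> Prop) (u : (nat -> M) -> M) :
  definable_pred A -> definable_term u -> definable (fun e => A (u e)).
Proof.
  intros HA Hu; apply (definable_equiv _ (fun e => exists x, x = u e /\ A x)).
  - intro e; split; [eauto | intros (x & -> & H); exact H].
  - apply definable_ex, definable_and; [exact Hu | exact (definable_rename _ (fun n => n) HA)].
Qed.

Lemma rel_term (R : M -> M -> Prop) (u v : (nat -> M) -> M) :
  definable_rel R -> definable_term u -> definable_term v -> definable (fun e => R (u e) (v e)).
Proof.
  intros HR Hu Hv; apply (definable_equiv _ (fun e => exists x, x = u e /\ exists y, y = v e /\ R x y)).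
  - intro e; split; [eauto 6 | intros (x & -> & y & -> & H); exact H].
  - apply definable_ex, definable_and; [exact Hu |].
    apply definable_ex, definable_and; [exact (term_rename v S Hv) |].
    exact (definable_rename _ (fun n => match n with 0 => 1 | 1 => 0 | _ => n end) HR).
Qed.

Lemma map_term (F : M -> M) (u : (nat -> M) -> M) :
  definable_map F -> definable_term u -> definable_term (fun e => F (u e)).
Proof.
  intros HF Hu; apply (definable_equiv _ (fun e => exists x, x = u (fun n => e (S n)) /\ e 0 = F x)).
  - intro e; split; [eauto | intros (x & -> & H); exact H].
  - apply definable_ex, definable_and; [exact (term_rename u S Hu) |].
    exact (definable_rename _ (fun n => match n with 0 => 1 | 1 => 0 | _ => n end) HF).
Qed.

Lemma map2_term (F : M -> M -> M) (u v : (nat -> M) -> M) :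
  definable_map2 F -> definable_term u -> definable_term v ->
  definable_term (fun e => F (u e) (v e)).
Proof.
  intros HF Hu Hv; apply (definable_equiv _ (fun e =>
    exists x, x = u (fun n => e (S n)) /\ exists y, y = v (fun n => e (S n)) /\ e 0 = F x y)).
  - intro e; split; [eauto 6 | intros (x & -> & y & -> & H); exact H].
  - apply definable_ex, definable_and; [exact (term_rename u S Hu) |].
    apply definable_ex, definable_and; [exact (term_rename v (fun n => S (S n)) Hv) |].
    exact (definable_rename _
      (fun n => match n with 0 => 2 | 1 => 1 | 2 => 0 | _ => n end) HF).
Qed.

Context (HZF : ZF M).

Lemma model_inhabited : inhabited M.
Proof. destruct (zf_infinity HZF) as [w _]; exact (inhabits w). Qed.

(** Definite description.  The default is one fixed element: an arbitrary
    element depending on [A] would make the term undefinable. *)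
Definition the (A : M -> Prop) : M :=
  epsilon model_inhabited
    (fun z => (exists! v, A v) /\ A z \/
              ~ (exists! v, A v) /\ z = epsilon model_inhabited (fun _ => True)).

Lemma the_spec_total A :
  (exists! v, A v) /\ A (the A) \/
  ~ (exists! v, A v) /\ the A = epsilon model_inhabited (fun _ => True).
Proof.
  pattern (the A); unfold the; apply epsilon_spec.
  destruct (classic (exists! v, A v)) as [H | H].
  - assert (H' := H); destruct H' as [v Hv]; exists v; left; split; [exact H | apply Hv].
  - eexists; right; eauto.
Qed.

Lemma the_eq (A : M -> Prop) z : A z -> (forall y, A y -> y = z) -> the A = z.
Proof.
  intros Hz U; destruct (the_spec_total A) as [[_ H] | [H _]]; [auto |].
  destruct H; exists z; split; [exact Hz | intros y Hy; symmetry; auto].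
Qed.

Lemma the_spec (A : M -> Prop) : (exists z, A z) -> (forall y z, A y -> A z -> y = z) -> A (the A).
Proof.
  intros [z Hz] U; rewrite (the_eq A z); auto.
Qed.

Lemma term_the (A : M -> (nat -> M) -> Prop) :
  definable (fun e => A (e 0) (fun n => e (S n))) ->
  definable_term (fun e => the (fun v => A v e)).
Proof.
  intro HA.
  assert (HA1 : definable (fun e => A (e 0) (fun n => e (S (S n))))).
  { exact (definable_rename _ (lift S) HA). }
  assert (HA2 : definable (fun e => A (e 0) (fun n => e (S (S (S n)))))).
  { exact (definable_rename _ (lift (fun n => S (S n))) HA). }
  assert (HU : definable (fun e => exists! v, A v (fun n => e (S n)))).
  { apply definable_ex; unfold unique; apply definable_and; [exact HA1 |].
    apply definable_all, definable_imp; [exact HA2 |].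
    apply definable_eq; apply term_var. }
  apply (definable_equiv _ (fun e =>
    (exists! v, A v (fun n => e (S n))) /\ A (e 0) (fun n => e (S n)) \/
    ~ (exists! v, A v (fun n => e (S n))) /\
      e 0 = epsilon model_inhabited (fun _ => True))).
  - intro e; destruct (the_spec_total (fun v => A v (fun n => e (S n)))) as [[H1 H2] | [H1 H2]].
    + split; [intros ->; auto |].
      intros [[_ H] | [H _]]; [| contradiction].
      destruct H1 as (v & _ & Hv); rewrite <- (Hv _ H2); symmetry; auto.
    + rewrite H2; tauto.
  - apply definable_or; apply definable_and; try assumption.
    + apply definable_imp; [exact HU | apply definable_const].
    + apply definable_eq; [apply term_var | apply term_const].
Qed.

(** Rules for further constructions are added by redefining this tactic. *)
Ltac definability_hook := fail.

(** Under binders a given term [u] is applied to a shifted environment; shifts by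
    at most [k] more than [s] are tried. *)
Ltac rename_hypothesis u H k s :=
  first [ exact (term_rename u s H)
        | match k with S ?k' => rename_hypothesis u H k' (fun n => S (s n)) end ].

Ltac definability_step :=
  cbv beta;
  match goal with
  | |- definable (fun _ => ?A) => apply definable_const
  | |- definable (fun e => ex _) => apply definable_ex
  | |- definable (fun e => _ /\ _) => apply definable_and
  | |- definable (fun e => _ \/ _) => apply definable_or
  | |- definable (fun e => _ <-> _) => unfold iff
  | |- definable (fun e => ~ _) => unfold not
  | |- definable (fun e => unique _ _) => unfold unique
  | |- definable (fun e => _ = _) => apply definable_eq
  | |- definable (fun e => _ ∈ _) => apply definable_mem
  | |- definable (fun e => ?A -> ?B) => apply definable_imp
  | |- definable (fun e => forall x, _) => apply definable_all
  | |- definable_term (fun _ => ?c) => apply term_const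
  | |- definable_term (fun e => e _) => apply term_var
  | |- definable_term (fun e => the _) => apply term_the
  | H : definable_term ?u |- definable_term (fun e => ?u _) =>
      rename_hypothesis u H 5 (fun n : nat => n)
  | H : definable_pred ?A |- definable (fun e => ?A _) => apply (pred_term A _ H)
  | H : definable_rel ?R |- definable (fun e => ?R _ _) => apply (rel_term R _ _ H)
  | H : definable_map ?F |- definable_term (fun e => ?F _) => apply (map_term F _ H)
  | H : definable_map2 ?F |- definable_term (fun e => ?F _ _) => apply (map2_term F _ _ H)
  | _ => definability_hook
  end.

Ltac definability :=
  intros; unfold definable_pred, definable_rel, definable_map, definable_map2;
  solve [repeat definability_step].

Lemma separation (A : M -> Prop) a :
  definable_pred A -> exists z, forall y, y ∈ z <-> y ∈ a /\ A y.
Proof.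
  intro H; destruct (definable_bind _ H) as (p & r & E).
  destruct (zf_separation HZF p (lookup r (fun _ => a)) a) as [z Hz]; exists z; intro y.
  rewrite Hz, <- (E y (fun _ => a)); reflexivity.
Qed.

Lemma replacement (F : M -> M) a :
  definable_map F -> exists z, forall y, y ∈ z <-> exists x, x ∈ a /\ y = F x.
Proof.
  intro H; destruct (definable_bind2 _ a H) as (p & e0 & E); simpl in E.
  destruct (zf_replacement HZF p e0 a) as [z Hz].
  - intros y _ z z' Hz Hz'; apply E in Hz, Hz'; congruence.
  - exists z; intro y; rewrite Hz; split; intros (x & Hx & Hy); exists x; split; auto; apply E; auto.
Qed.

(** * Sets *)

Implicit Types a b c d f g p t w x y z X Y : M.

Definition upair x y : M := the (fun z => is_upair z x y).
Definition opair x y : M := upair (upair x x) (upair x y).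
Definition bigunion x : M := the (fun z => forall w, w ∈ z <-> exists y, y ∈ x /\ w ∈ y).
Definition power x : M := the (fun z => is_powerset z x).
Definition succ x : M := the (fun z => is_succ z x).
Definition sep a (A : M -> Prop) : M := the (fun z => forall y, y ∈ z <-> y ∈ a /\ A y).
Definition image a (F : M -> M) : M :=
  the (fun z => forall y, y ∈ z <-> exists x, x ∈ a /\ y = F x).
Definition lam a (F : M -> M) : M := image a (fun x => opair x (F x)).
Definition ap f x : M := the (app f x).

Lemma set_ext x y : (forall z, z ∈ x <-> z ∈ y) -> x = y.
Proof. apply (zf_extensionality HZF). Qed.

(** By Extensionality a set is described uniquely by its elements. *)
Lemma the_set (A : M -> Prop) :
  (exists z, forall y, y ∈ z <-> A y) ->
  forall y, y ∈ the (fun z => forall y, y ∈ z <-> A y) <-> A y.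
Proof.
  intro H; apply (the_spec (fun z => forall y, y ∈ z <-> A y)); [exact H |].
  intros y z Hy Hz; apply set_ext; intro w; rewrite Hy, Hz; reflexivity.
Qed.

Lemma in_upair w x y : w ∈ upair x y <-> w = x \/ w = y.
Proof. apply the_set, (zf_pairing HZF). Qed.

Lemma in_bigunion w x : w ∈ bigunion x <-> exists y, y ∈ x /\ w ∈ y.
Proof. apply (the_set (fun w => exists y, y ∈ x /\ w ∈ y)), (zf_union HZF). Qed.

Lemma in_power w x : w ∈ power x <-> subset w x.
Proof. apply (the_set (fun w => subset w x)), (zf_powerset HZF). Qed.

Lemma in_succ w x : w ∈ succ x <-> w ∈ x \/ w = x.
Proof.
  apply (the_set (fun w => w ∈ x \/ w = x)).
  exists (bigunion (upair x (upair x x))); intro y; rewrite in_bigunion; split.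
  - intros (z & [-> | ->]%in_upair & Hy); [auto | apply in_upair in Hy; tauto].
  - intros [H | ->]; [exists x | exists (upair x x)]; rewrite !in_upair; auto.
Qed.

Lemma in_sep y a (A : M -> Prop) :
  definable_pred A -> (y ∈ sep a A <-> y ∈ a /\ A y).
Proof. intro H; apply (the_set (fun y => y ∈ a /\ A y)), separation, H. Qed.

Lemma in_image y a (F : M -> M) :
  definable_map F -> (y ∈ image a F <-> exists x, x ∈ a /\ y = F x).
Proof. intro H; apply (the_set (fun y => exists x, x ∈ a /\ y = F x)), replacement, H. Qed.

Lemma upair_inj x y x' y' : upair x y = upair x' y' -> x = x' /\ y = y' \/ x = y' /\ y = x'.
Proof.
  intro E.
  assert (H : forall w, w = x \/ w = y <-> w = x' \/ w = y')
    by (intro w; rewrite <- !in_upair, E; reflexivity).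
  pose proof (proj1 (H x) (or_introl eq_refl)).
  pose proof (proj1 (H y) (or_intror eq_refl)).
  pose proof (proj2 (H x') (or_introl eq_refl)).
  pose proof (proj2 (H y') (or_intror eq_refl)).
  intuition congruence.
Qed.

Lemma opair_inj x y x' y' : opair x y = opair x' y' -> x = x' /\ y = y'.
Proof.
  unfold opair; intros [[E1 E2] | [E1 E2]]%upair_inj;
    apply upair_inj in E1, E2; intuition congruence.
Qed.

Lemma is_upair_eq z x y : is_upair z x y <-> z = upair x y.
Proof.
  split; [intro H; apply set_ext; intro w; rewrite in_upair; apply H |].
  intros -> w; apply in_upair.
Qed.

Lemma is_opair_eq p x y : is_opair p x y <-> p = opair x y.
Proof.
  unfold is_opair; split.
  - intros (a & b & -> %is_upair_eq & -> %is_upair_eq & -> %is_upair_eq); reflexivity.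
  - intros ->; exists (upair x x), (upair x y); rewrite !is_upair_eq; auto.
Qed.

Lemma app_opair f x y : app f x y <-> opair x y ∈ f.
Proof.
  unfold app; split.
  - intros (p & -> %is_opair_eq & H); exact H.
  - intro H; exists (opair x y); rewrite is_opair_eq; auto.
Qed.

(** ** Definability of the set constructions *)

Lemma term_upair (u v : (nat -> M) -> M) : definable_term u -> definable_term v ->
  definable_term (fun e => upair (u e) (v e)).
Proof. unfold upair, is_upair; definability. Qed.

Lemma term_opair (u v : (nat -> M) -> M) : definable_term u -> definable_term v ->
  definable_term (fun e => opair (u e) (v e)).
Proof. intros; unfold opair; repeat apply term_upair; assumption. Qed.

Lemma term_bigunion (u : (nat -> M) -> M) : definable_term u ->
  definable_term (fun e => bigunion (u e)).
Proof. unfold bigunion; definability. Qed.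

Lemma term_power (u : (nat -> M) -> M) : definable_term u ->
  definable_term (fun e => power (u e)).
Proof. unfold power, is_powerset, subset; definability. Qed.

Lemma term_succ (u : (nat -> M) -> M) : definable_term u ->
  definable_term (fun e => succ (u e)).
Proof. unfold succ, is_succ; definability. Qed.

Lemma term_ap (u v : (nat -> M) -> M) : definable_term u -> definable_term v ->
  definable_term (fun e => ap (u e) (v e)).
Proof. unfold ap, app, is_opair, is_upair; definability. Qed.

Lemma term_sep (u : (nat -> M) -> M) (A : M -> (nat -> M) -> Prop) : definable_term u ->
  definable (fun e => A (e 0) (fun n => e (S n))) ->
  definable_term (fun e => sep (u e) (fun x => A x e)).
Proof.
  intros Hu HA; unfold sep; apply term_the, definable_all.
  assert (HA' := definable_rename _ (lift S) HA); cbn in HA'.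
  unfold iff; repeat (apply definable_and || apply definable_imp); try exact HA'; definability.
Qed.

Lemma term_image (u : (nat -> M) -> M) (F : M -> (nat -> M) -> M) : definable_term u ->
  definable_term (fun e => F (e 0) (fun n => e (S n))) ->
  definable_term (fun e => image (u e) (fun x => F x e)).
Proof.
  intros Hu HF; unfold image; apply term_the, definable_all.
  assert (HF' := term_rename _ (lift (fun n => S (S n))) HF); cbn in HF'.
  unfold iff; repeat (apply definable_and || apply definable_imp); try apply definable_ex;
    repeat apply definable_and; try apply (definable_eq _ _ (term_var _) HF'); definability.
Qed.

Lemma term_lam (u : (nat -> M) -> M) (F : M -> (nat -> M) -> M) : definable_term u ->
  definable_term (fun e => F (e 0) (fun n => e (S n))) ->
  definable_term (fun e => lam (u e) (fun x => F x e)).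
Proof.
  intros Hu HF; unfold lam; apply (term_image u (fun x e => opair x (F x e)) Hu).
  apply term_opair; [apply term_var | exact HF].
Qed.

Ltac definability_hook ::=
  match goal with
  | |- definable_term (fun e => upair _ _) => apply term_upair
  | |- definable_term (fun e => opair _ _) => apply term_opair
  | |- definable_term (fun e => bigunion _) => apply term_bigunion
  | |- definable_term (fun e => power _) => apply term_power
  | |- definable_term (fun e => succ _) => apply term_succ
  | |- definable_term (fun e => ap _ _) => apply term_ap
  | |- definable_term (fun e => sep _ _) => apply term_sep
  | |- definable_term (fun e => image _ _) => apply term_image
  | |- definable_term (fun e => lam _ _) => apply term_lam
  | _ => progress unfold subset, nonempty, is_empty, is_ordinal, ord_le, is_limit, is_succ,
      is_fun, maps_to, is_onto, app, is_opair, is_upair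
  end.

(** ** Functions *)

Lemma app_lam a F x y : definable_map F ->
  (app (lam a F) x y <-> x ∈ a /\ y = F x).
Proof.
  intro HF; rewrite app_opair; unfold lam; rewrite in_image by definability; split.
  - intros (x' & Hx & [-> ->]%opair_inj); auto.
  - intros [Hx ->]; exists x; auto.
Qed.

Lemma ap_eq f x y : app f x y -> (forall z, app f x z -> z = y) -> ap f x = y.
Proof. intros; apply the_eq; auto. Qed.

Lemma ap_lam a F x : definable_map F -> x ∈ a -> ap (lam a F) x = F x.
Proof.
  intros HF Hx; apply ap_eq; [apply app_lam; auto |].
  intros z [_ H]%app_lam; assumption.
Qed.

Lemma lam_fun a F : definable_map F -> is_fun (lam a F) a.
Proof.
  intro HF; split.
  - unfold lam; intros p (x & Hx & ->)%in_image; [| definability].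
    exists x, (F x); rewrite is_opair_eq; auto.
  - intros x Hx; exists (F x); split; [apply app_lam; auto |].
    intros y [_ ->]%app_lam; auto.
Qed.

Lemma lam_ext a F G : definable_map F -> definable_map G ->
  (forall x, x ∈ a -> F x = G x) -> lam a F = lam a G.
Proof.
  intros HF HG E; apply set_ext; intro p; unfold lam; rewrite !in_image by definability.
  split; intros (x & Hx & ->); exists x; split; auto; rewrite E; auto.
Qed.

Lemma app_ap f X x y : is_fun f X -> x ∈ X -> (app f x y <-> y = ap f x).
Proof.
  intros [_ Hf] Hx; destruct (Hf x Hx) as (y0 & H0 & U).
  rewrite (ap_eq f x y0); [| exact H0 | intros; symmetry; auto].
  split; [intro; symmetry; auto | intros ->; exact H0].
Qed.

(** The power set only serves to collect the product in a set: such a function is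
    a set of pairs [(t, y)] with [y] in [A t]. *)
Definition prod X (A : M -> M) : M :=
  sep (power (bigunion (image X (fun t => image (A t) (opair t)))))
    (fun g => is_fun g X /\ forall t, t ∈ X -> ap g t ∈ A t).

Lemma in_prod X A g : definable_map A ->
  (g ∈ prod X A <-> is_fun g X /\ forall t, t ∈ X -> ap g t ∈ A t).
Proof.
  intro HA; unfold prod; rewrite in_sep by definability.
  rewrite in_power; split; [tauto | intros [Hf Hv]; split; [| auto]].
  intros p Hp; destruct (proj1 Hf p Hp) as (t & y & Ht & E).
  apply is_opair_eq in E; subst p.
  rewrite in_bigunion; exists (image (A t) (opair t)); split.
  - rewrite in_image by definability; eauto.
  - rewrite in_image by definability; exists y; split; [| auto].
    rewrite (proj1 (app_ap g X t y Hf Ht)); [auto | apply app_opair, Hp].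
Qed.

(** * Ordinals *)

Definition empty : M := the is_empty.

Lemma not_in_empty x : ~ x ∈ empty.
Proof.
  apply (the_spec is_empty).
  - destruct (zf_infinity HZF) as (w & (x0 & _ & H) & _); eauto.
  - intros y z Hy Hz; apply set_ext; intro w; split; intro; [destruct (Hy w) | destruct (Hz w)]; auto.
Qed.

Lemma mem_no_cycle3 x y z : x ∈ y -> y ∈ z -> z ∈ x -> False.
Proof.
  intros H1 H2 H3.
  destruct (zf_foundation HZF (bigunion (upair (upair x y) (upair z z)))) as (w & Hw & Hmin).
  - exists x; rewrite in_bigunion; exists (upair x y); rewrite !in_upair; auto.
  - assert (Hin : forall w, w ∈ bigunion (upair (upair x y) (upair z z)) <-> w = x \/ w = y \/ w = z).
    { intro w'; rewrite in_bigunion; split.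
      - intros (v & [-> | ->]%in_upair & H%in_upair); tauto.
      - intros [-> | [-> | ->]]; [exists (upair x y) | exists (upair x y) | exists (upair z z)];
          rewrite !in_upair; auto. }
    apply Hin in Hw; destruct Hw as [-> | [-> | ->]];
      [apply (Hmin z) | apply (Hmin x) | apply (Hmin y)]; auto; apply Hin; auto.
Qed.

Lemma mem_irrefl x : ~ x ∈ x.
Proof. intro H; exact (mem_no_cycle3 x x x H H H). Qed.

Lemma mem_asym x y : x ∈ y -> ~ y ∈ x.
Proof.
  intros H H'.
  destruct (zf_foundation HZF (upair x y)) as (w & Hw & Hmin).
  - exists x; rewrite in_upair; auto.
  - apply in_upair in Hw; destruct Hw as [-> | ->];
      [apply (Hmin y) | apply (Hmin x)]; auto; rewrite in_upair; auto.
Qed.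

Lemma ord_trans a x y : is_ordinal a -> x ∈ y -> y ∈ a -> x ∈ a.
Proof. intros [Ha _] Hx Hy; exact (Ha y Hy x Hx). Qed.

Lemma ord_mem a x : is_ordinal a -> x ∈ a -> is_ordinal x.
Proof.
  intros [Ht Hc] Hx; split.
  - intros y Hy z Hz.
    assert (Hya : y ∈ a) by exact (Ht x Hx y Hy).
    assert (Hza : z ∈ a) by exact (Ht y Hya z Hz).
    destruct (Hc z x Hza Hx) as [H | [-> | H]]; [exact H | |].
    + destruct (mem_asym _ _ Hy Hz).
    + destruct (mem_no_cycle3 _ _ _ Hz Hy H).
  - intros y z Hy Hz; apply Hc; apply (Ht x Hx); assumption.
Qed.

(** If [c] is not all of [a], it is the least element of [a] outside [c]. *)
Lemma transitive_subset_mem a c : is_ordinal a -> subset c a ->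
  (forall x y, x ∈ y -> y ∈ c -> x ∈ c) -> c = a \/ c ∈ a.
Proof.
  intros [Ht Hc] Hsub Hct.
  assert (Hin : forall w, w ∈ sep a (fun w => ~ w ∈ c) <-> w ∈ a /\ ~ w ∈ c)
    by (intro w; apply in_sep; definability).
  destruct (classic (nonempty (sep a (fun w => ~ w ∈ c)))) as [Hne | Hno].
  - right; destruct (zf_foundation HZF _ Hne) as (y & [Hya Hyc]%Hin & Hmin).
    replace c with y; [exact Hya |]; apply set_ext; intro z; split; intro Hz.
    + apply NNPP; intro Hzc; apply (Hmin z Hz), Hin; split; [exact (Ht y Hya z Hz) | auto].
    + destruct (Hc z y (Hsub z Hz) Hya) as [H | [-> | H]]; [auto | contradiction |].
      destruct (Hyc (Hct y z H Hz)).
  - left; apply set_ext; intro z; split; [apply Hsub | intro Hz].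
    apply NNPP; intro Hzc; apply Hno; exists z; apply Hin; auto.
Qed.

Lemma ord_trichotomy a b : is_ordinal a -> is_ordinal b -> a ∈ b \/ a = b \/ b ∈ a.
Proof.
  intros Ha Hb.
  set (c := sep a (fun x => x ∈ b)).
  assert (Hin : forall w, w ∈ c <-> w ∈ a /\ w ∈ b)
    by (intro w; unfold c; rewrite in_sep by definability; reflexivity).
  assert (Hct : forall x y, x ∈ y -> y ∈ c -> x ∈ c).
  { intros x y Hx [Hya Hyb]%Hin; apply Hin; split; eapply ord_trans; eauto. }
  destruct (transitive_subset_mem a c Ha) as [Ea | Ma]; auto; [intros x Hx; apply Hin, Hx | |];
    (destruct (transitive_subset_mem b c Hb) as [Eb | Mb]; auto; [intros x Hx; apply Hin, Hx | |]).
  - right; left; congruence.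
  - left; congruence.
  - right; right; congruence.
  - destruct (mem_irrefl c); apply Hin; auto.
Qed.

Lemma ord_le_subset a b : is_ordinal a -> is_ordinal b -> subset a b -> ord_le a b.
Proof.
  intros Ha Hb H; destruct (ord_trichotomy a b Ha Hb) as [K | [K | K]]; [left | right |]; auto.
  destruct (mem_irrefl b (H b K)).
Qed.

Lemma ord_not_mem a b : is_ordinal a -> is_ordinal b -> ~ a ∈ b -> ord_le b a.
Proof.
  intros Ha Hb H; destruct (ord_trichotomy a b Ha Hb) as [K | [K | K]]; unfold ord_le; auto; contradiction.
Qed.

Lemma ord_le_mem a b c : is_ordinal c -> ord_le a b -> b ∈ c -> a ∈ c.
Proof. intros Hc [H | ->] Hb; [exact (ord_trans c a b Hc H Hb) | exact Hb]. Qed.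

Lemma ord_mem_le a b c : is_ordinal c -> a ∈ b -> ord_le b c -> a ∈ c.
Proof. intros Hc Ha [H | <-]; [exact (ord_trans c a b Hc Ha H) | exact Ha]. Qed.

Lemma ord_le_antisym a b : ord_le a b -> ord_le b a -> a = b.
Proof. intros [H | H] [K | K]; auto; destruct (mem_asym _ _ H K). Qed.

Lemma ord_succ a : is_ordinal a -> is_ordinal (succ a).
Proof.
  intro Ha; split.
  - intros x [Hx | ->]%in_succ y Hy; apply in_succ; left; [eapply ord_trans |]; eauto.
  - intros x y Hx Hy; apply ord_trichotomy; apply in_succ in Hx, Hy;
      [destruct Hx as [Hx | ->] | destruct Hy as [Hy | ->]]; eauto using ord_mem.
Qed.

Lemma ord_bigunion x : (forall a, a ∈ x -> is_ordinal a) -> is_ordinal (bigunion x).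
Proof.
  intro H; split.
  - intros y (a & Ha & Hy)%in_bigunion z Hz; apply in_bigunion; exists a; split; auto.
    eapply ord_trans; eauto.
  - intros y z (a & Ha & Hy)%in_bigunion (b & Hb & Hz)%in_bigunion.
    apply ord_trichotomy; eapply ord_mem; [apply (H a) | | apply (H b) |]; eauto.
Qed.

Lemma ord_least (A : M -> Prop) a : definable_pred A -> is_ordinal a -> A a ->
  exists b, is_ordinal b /\ A b /\ forall c, c ∈ b -> ~ A c.
Proof.
  intros HA Ha Aa.
  assert (Hin : forall w, w ∈ sep (succ a) A <-> w ∈ succ a /\ A w) by (intro w; apply in_sep, HA).
  destruct (zf_foundation HZF (sep (succ a) A)) as (b & [Hb Ab]%Hin & Hmin).
  - exists a; apply Hin; rewrite in_succ; auto.
  - exists b; repeat split; auto; try apply (ord_mem (succ a) b (ord_succ a Ha) Hb).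
    intros c Hc Ac; apply (Hmin c Hc), Hin; split; [| exact Ac].
    eapply ord_trans; eauto using ord_succ.
Qed.

Lemma ord_ind (A : M -> Prop) : definable_pred A ->
  (forall a, is_ordinal a -> (forall b, b ∈ a -> A b) -> A a) ->
  forall a, is_ordinal a -> A a.
Proof.
  intros HA IH a Ha; apply NNPP; intro Hn.
  destruct (ord_least (fun a => ~ A a) a) as (b & Hb & Hnb & Hmin); auto.
  - apply definable_imp; [exact HA | apply definable_const].
  - apply Hnb, IH; auto; intros c Hc; apply NNPP, (Hmin c Hc).
Qed.

Lemma least_ordinal_exists (A : M -> Prop) a : definable_pred A -> is_ordinal a -> A a ->
  is_least_ordinal A (the (is_least_ordinal A)).
Proof.
  intros HA Ha Aa; apply (the_spec (is_least_ordinal A)).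
  - destruct (ord_least A a HA Ha Aa) as (b & Hb & Ab & Hmin).
    exists b; repeat split; try apply Hb; auto; intros c Hc Ac.
    apply ord_not_mem; auto; intro H; exact (Hmin c H Ac).
  - intros y z (Hy & Ay & Ly) (Hz & Az & Lz); apply ord_le_antisym; auto.
Qed.

Lemma limit_succ d x : is_limit d -> x ∈ d -> succ x ∈ d.
Proof.
  intros (Hd & _ & Hlim) Hx; destruct (Hlim x Hx) as (y & Hy & Hxy).
  assert (Ho := ord_mem d).
  assert (is_ordinal y) by eauto.
  eapply ord_le_mem; [exact Hd | | exact Hy].
  apply ord_not_mem; [auto | apply ord_succ; eauto |].
  intros [H1 | ->]%in_succ; [exact (mem_asym _ _ Hxy H1) | exact (mem_irrefl _ Hxy)].
Qed.

(** Case distinction as a term: [A] does not involve the element being separated,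
    so all of [x] remains or nothing does. *)
Definition guard (A : Prop) x : M := sep x (fun _ => A).

Lemma guard_true (A : Prop) x : A -> guard A x = x.
Proof.
  intro HA; apply set_ext; intro y; unfold guard; rewrite in_sep by definability; tauto.
Qed.

Lemma guard_false (A : Prop) x : ~ A -> guard A x = empty.
Proof.
  intro HA; apply set_ext; intro y; unfold guard; rewrite in_sep by definability.
  split; [tauto | intro H; destruct (not_in_empty _ H)].
Qed.

Lemma ord_empty : is_ordinal empty.
Proof. split; intros x; [intro H | intros y H]; destruct (not_in_empty _ H). Qed.

Lemma empty_mem a : is_ordinal a -> nonempty a -> empty ∈ a.
Proof.
  intros Ha [x Hx]; destruct (ord_trichotomy empty a ord_empty Ha) as [H | [<- | H]]; auto;
    [destruct (not_in_empty _ Hx) | destruct (not_in_empty _ H)].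
Qed.

Lemma ord_max_ub x y : is_ordinal x -> is_ordinal y ->
  ord_le x (bigunion (upair x y)) /\ ord_le y (bigunion (upair x y)).
Proof.
  intros Hx Hy.
  assert (Ho : is_ordinal (bigunion (upair x y)))
    by (apply ord_bigunion; intros z [-> | ->]%in_upair; assumption).
  split; apply ord_le_subset; auto; intros z Hz; apply in_bigunion;
    [exists x | exists y]; rewrite in_upair; auto.
Qed.

Lemma ord_max_mem d x y : is_ordinal d -> x ∈ d -> y ∈ d -> bigunion (upair x y) ∈ d.
Proof.
  intros Hd Hx Hy.
  assert (Ox := ord_mem d x Hd Hx); assert (Oy := ord_mem d y Hd Hy).
  assert (E : forall z, z ∈ bigunion (upair x y) <-> z ∈ x \/ z ∈ y).
  { intro z; rewrite in_bigunion; split.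
    - intros (w & [-> | ->]%in_upair & H); auto.
    - intros [H | H]; [exists x | exists y]; rewrite in_upair; auto. }
  destruct (ord_trichotomy x y Ox Oy) as [H | [<- | H]].
  - replace (bigunion (upair x y)) with y; [exact Hy |].
    apply set_ext; intro z; rewrite E; split; [auto | intros [Hz |]; eauto using ord_trans].
  - replace (bigunion (upair x x)) with x; [exact Hx |].
    apply set_ext; intro z; rewrite E; tauto.
  - replace (bigunion (upair x y)) with x; [exact Hx |].
    apply set_ext; intro z; rewrite E; split; [auto | intros [| Hz]; eauto using ord_trans].
Qed.

(** * Recursion on ordinals *)

(** The value at [x] is read off from any [g] obeying the recursion below [x].
    Two such [g] agree by induction, so the value is a definite description and
    hence definable. *)
Lemma transfinite_recursion (G : M -> M -> M) : definable_map2 G ->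
  exists R, definable_map R /\ forall x, is_ordinal x -> R x = G x (lam x R).
Proof.
  intro HG.
  (* Only the values of [g] below [x] matter, so [g] need not have domain [x]. *)
  set (attempt := fun g x => forall y, y ∈ x -> ap g y = G y (lam y (ap g))).
  assert (Hunique : forall g x g' x' y, is_ordinal x -> is_ordinal x' ->
    attempt g x -> attempt g' x' -> y ∈ x -> y ∈ x' -> ap g y = ap g' y).
  { intros g x g' x' y Ox Ox' Hg Hg' Hy Hy'.
    assert (Oy : is_ordinal y) by (eapply ord_mem; eauto).
    revert y Oy Hy Hy'.
    apply (ord_ind (fun y => y ∈ x -> y ∈ x' -> ap g y = ap g' y)); [definability |].
    intros z Oz IH Hz Hz'; rewrite (Hg z Hz), (Hg' z Hz'); f_equal.
    apply lam_ext; [definability | definability |].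
    intros w Hw; apply IH; eauto using ord_trans. }
  set (R := fun x => the (fun v => exists g, attempt g x /\ v = G x (lam x (ap g)))).
  assert (HR : definable_map R) by (unfold R, attempt; definability).
  assert (R_eq : forall x g, is_ordinal x -> attempt g x -> R x = G x (lam x (ap g))).
  { intros x g Ox Hg; apply the_eq; [eauto |].
    intros v (g' & Hg' & ->); f_equal; apply lam_ext; [definability | definability |].
    intros y Hy; eauto. }
  assert (Hex : forall x, is_ordinal x -> attempt (lam x R) x).
  { apply (ord_ind (fun x => attempt (lam x R) x)); [unfold attempt; definability |].
    intros x Ox IH y Hy; rewrite ap_lam by auto.
    rewrite (R_eq y (lam y R)); [| eapply ord_mem |]; eauto.
    f_equal; apply lam_ext; [definability | definability |].
    intros z Hz; rewrite !ap_lam; eauto using ord_trans. }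
  exists R; split; [exact HR |].
  intros x Ox; rewrite (R_eq x _ Ox (Hex x Ox)); f_equal.
  apply lam_ext; [definability | exact HR |].
  intros y Hy; apply ap_lam; auto.
Qed.

(** The Mostowski collapse [pi x = {pi y : y in C, y < x}]. *)
Lemma order_type C : (forall x, x ∈ C -> is_ordinal x) ->
  exists a pi, is_ordinal a /\ definable_map pi /\
    (forall x, x ∈ C -> pi x ∈ a) /\
    (forall x y, x ∈ C -> y ∈ C -> x ∈ y -> pi x ∈ pi y) /\
    (forall z, z ∈ a -> exists x, x ∈ C /\ pi x = z).
Proof.
  intro HC.
  destruct (transfinite_recursion (fun x g => image (sep x (fun y => y ∈ C)) (ap g)))
    as (pi & Hpi & E); [definability |].
  assert (Epi : forall x, x ∈ C -> forall z, z ∈ pi x <-> exists y, y ∈ x /\ y ∈ C /\ z = pi y).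
  { intros x Hx z; rewrite E by auto; rewrite in_image by definability; split.
    - intros (y & [Hy HyC]%in_sep & ->); [| definability].
      rewrite ap_lam by auto; eauto.
    - intros (y & Hy & HyC & ->); exists y; rewrite in_sep by definability.
      rewrite ap_lam by auto; auto. }
  assert (Hmono : forall x y, x ∈ C -> y ∈ C -> x ∈ y -> pi x ∈ pi y)
    by (intros x y Hx Hy Hxy; apply Epi; eauto).
  assert (Hin : forall z, z ∈ image C pi <-> exists x, x ∈ C /\ z = pi x)
    by (intro z; apply in_image, Hpi).
  exists (image C pi), pi; repeat split; auto.
  - intros z (x & Hx & ->)%Hin w (y & _ & Hy & ->)%(Epi x Hx); apply Hin; eauto.
  - intros z z' (x & Hx & ->)%Hin (x' & Hx' & ->)%Hin.
    destruct (ord_trichotomy x x') as [H | [-> | H]]; auto.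
  - intros x Hx; apply Hin; eauto.
  - intros z (x & Hx & ->)%Hin; eauto.
Qed.

(** The recursion is [s i = sup {K j (s j) + 1 : j < i}], stopped at the least [a]
    where the value leaves [d].  It stops at [d] at the latest, because the least
    [i] with [s i < i] would satisfy [s (s i) < s i].  The values below [a] are
    unbounded in [d], since their supremum is [s a]. *)
Lemma thinning d K : is_limit d -> definable_map2 K ->
  (forall i b, i ∈ d -> b ∈ d -> K i b ∈ d /\ ord_le b (K i b)) ->
  exists a s, is_limit a /\ ord_le a d /\ definable_map s /\
    (forall i, i ∈ a -> s i ∈ d) /\
    (forall i j, i ∈ j -> j ∈ a -> K i (s i) ∈ s j) /\
    (forall x, x ∈ d -> exists i, i ∈ a /\ x ∈ s i).
Proof.
  intros Hd HK HKd; assert (Od : is_ordinal d) by apply Hd.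
  destruct (transfinite_recursion (fun x g => bigunion (image x (fun j => succ (K j (ap g j))))))
    as (s & Hs & E); [definability |].
  assert (Es : forall x, is_ordinal x -> forall y,
    y ∈ s x <-> exists j, j ∈ x /\ ord_le y (K j (s j))).
  { intros x Ox y; rewrite E by auto; rewrite in_bigunion; split.
    - intros (z & (j & Hj & ->)%in_image & Hy%in_succ); [| definability].
      rewrite ap_lam in Hy by auto; exists j; auto.
    - intros (j & Hj & Hy); exists (succ (K j (s j))); split; [| apply in_succ, Hy].
      rewrite in_image by definability; exists j; rewrite ap_lam; auto. }
  assert (Hex : exists i, is_ordinal i /\ ord_le i d /\ ~ s i ∈ d).
  { apply NNPP; intro Hno.
    assert (Hall : forall i, is_ordinal i -> ord_le i d -> s i ∈ d)
      by (intros i Oi Hi; apply NNPP; intro Hn; apply Hno; exists i; auto).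
    destruct (ord_least (fun i => ord_le i d /\ s i ∈ i) d) as (i & Oi & [Hi Hsi] & Hmin);
      [definability | exact Od | split; [right; reflexivity | apply Hall; [| right]; auto] |].
    assert (Hsd : s i ∈ d) by (apply Hall; auto).
    assert (Hssd : s (s i) ∈ d) by (apply Hall; [eapply ord_mem; eauto | left; auto]).
    apply (Hmin (s i) Hsi); split; [left; exact Hsd |].
    apply Es; eauto.
    exists (s i); split; [exact Hsi |]; apply HKd; auto. }
  destruct Hex as (i0 & Oi0 & Hi0).
  destruct (ord_least (fun i => ord_le i d /\ ~ s i ∈ d) i0) as (a & Oa & [Ha Hsa] & Hmin);
    [definability | auto | auto |].
  assert (Had : forall i, i ∈ a -> i ∈ d) by (intros i Hi; eapply ord_mem_le; eauto).
  assert (Hsd : forall i, i ∈ a -> s i ∈ d).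
  { intros i Hi; apply NNPP; intro Hn; apply (Hmin i Hi); split; [left; auto | exact Hn]. }
  assert (Hmono : forall i j, i ∈ j -> j ∈ a -> K i (s i) ∈ s j).
  { intros i j Hi Hj; apply Es; [eapply ord_mem; eauto |].
    exists i; split; [auto | right; reflexivity]. }
  assert (HKsd : forall i, i ∈ a -> K i (s i) ∈ d) by (intros; apply HKd; auto).
  assert (OK : forall i, i ∈ a -> is_ordinal (K i (s i)))
    by (intros i Hi; exact (ord_mem d _ Od (HKsd i Hi))).
  assert (Osa : is_ordinal (s a)).
  { rewrite E by auto; apply ord_bigunion; intros z (j & Hj & ->)%in_image; [| definability].
    rewrite ap_lam by auto; apply ord_succ, (ord_mem d _ Od), HKsd, Hj. }
  assert (Hcof : forall x, x ∈ d -> exists j, j ∈ a /\ ord_le x (K j (s j))).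
  { intros x Hx; apply Es; [exact Oa |].
    eapply ord_mem_le; [exact Osa | exact Hx | apply ord_not_mem; auto]. }
  assert (La : is_limit a).
  { split; [exact Oa |]; split.
    - destruct Hd as (_ & [x Hx] & _); destruct (Hcof x Hx) as (j & Hj & _); exists j; exact Hj.
    - intros j Hj.
      destruct (Hcof (succ (K j (s j)))) as (i & Hi & Hle); [apply limit_succ; auto |].
      exists i; split; [exact Hi |].
      assert (HKlt : K j (s j) ∈ K i (s i)).
      { apply (ord_mem_le _ (succ (K j (s j)))); [exact (OK i Hi) | apply in_succ; auto | exact Hle]. }
      destruct (ord_trichotomy i j) as [H | [-> | H]];
        [exact (ord_mem a i Oa Hi) | exact (ord_mem a j Oa Hj) | | | exact H].
      + assert (H1 : K i (s i) ∈ K j (s j)).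
        { apply (ord_mem_le _ (s j)); [exact (OK j Hj) | exact (Hmono i j H Hj) |].
          apply HKd; auto. }
        destruct (mem_asym _ _ H1 HKlt).
      + destruct (mem_irrefl _ HKlt). }
  exists a, s; do 5 (split; [assumption |]).
  intros x Hx; destruct (Hcof x Hx) as (j & Hj & Hle).
  exists (succ j); split; [apply limit_succ; auto |].
  eapply ord_le_mem; [eapply ord_mem; [exact Od |] | exact Hle | apply Hmono].
  - apply Hsd, limit_succ; auto.
  - apply in_succ; auto.
  - apply limit_succ; auto.
Qed.

(** * Products of ordinals modulo a filter *)

Context (Y PY : M) (HPY : is_powerset PY Y) (HAC : AC_on PY).
Context (alpha : M) (Halpha : ord_fun alpha Y).
Context (theta : M) (Htheta : is_theta PY theta).
Context (Hcf : forall t a : M, t ∈ Y -> app alpha t a ->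
  exists c : M, is_cf a c /\ ord_le theta c).

Lemma choice Z (R : M -> M -> Prop) : definable_rel R ->
  (forall B : M, B ∈ PY -> exists y, y ∈ Z /\ R B y) ->
  exists c, forall B : M, B ∈ PY -> ap c B ∈ Z /\ R B (ap c B).
Proof.
  intros HR H.
  assert (Hdef : definable_map (fun B => sep Z (R B))) by definability.
  destruct (HAC (lam PY (fun B => sep Z (R B)))) as (c & Hc & Hsel).
  - apply lam_fun, Hdef.
  - intros B A HB [_ ->]%app_lam; [| exact Hdef].
    destruct (H B HB) as (y & Hy & Ry); exists y; apply in_sep; [definability | auto].
  - exists c; intros B HB.
    assert (Hin : ap c B ∈ sep Z (R B)).
    { apply (Hsel B (sep Z (R B)) (ap c B) HB); [apply app_lam; auto |].
      apply (app_ap c PY); auto. }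
    apply in_sep in Hin; [exact Hin | definability].
Qed.

Lemma top_in_PY : Y ∈ PY.
Proof. apply HPY; intros t Ht; exact Ht. Qed.

Lemma alpha_ordinal t : t ∈ Y -> is_ordinal (ap alpha t).
Proof.
  intro Ht; apply (proj2 Halpha t); [exact Ht |].
  apply (app_ap alpha Y); [apply Halpha | exact Ht | reflexivity].
Qed.

(** Otherwise [C] is cofinal in [alpha_t], so its order type [a] is at least
    [cf(alpha_t)], hence at least [theta].  But [C] is an image of the power set,
    so the collapse of [C] would map the power set onto [theta]. *)
Lemma small_set_bounded t C u : t ∈ Y -> definable_map u -> subset C (ap alpha t) ->
  (forall y, y ∈ C -> exists B, B ∈ PY /\ y = u B) ->
  exists x, x ∈ ap alpha t /\ forall y, y ∈ C -> y ∈ x.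
Proof.
  intros Ht Hu HC Hsurj; apply NNPP; intro Hno.
  assert (Oa := alpha_ordinal t Ht).
  assert (OC : forall x, x ∈ C -> is_ordinal x) by (intros x Hx; exact (ord_mem _ _ Oa (HC x Hx))).
  assert (Hcof : forall x, x ∈ ap alpha t -> exists y, y ∈ C /\ ord_le x y).
  { intros x Hx; apply NNPP; intro Hn; apply Hno; exists x; split; [exact Hx |].
    intros y Hy; apply NNPP; intro Hyx; apply Hn; exists y; split; [exact Hy |].
    apply ord_not_mem; eauto using ord_mem. }
  destruct (order_type C OC) as (a & pi & Ha & Hpi & Hpia & Hmono & Honto).
  assert (Hinj : forall x y, x ∈ C -> y ∈ C -> pi x = pi y -> x = y).
  { intros x y Hx Hy E; destruct (ord_trichotomy x y) as [H | [H | H]]; auto;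
      apply Hmono in H; auto; rewrite E in H; destruct (mem_irrefl _ H). }
  set (e := fun z => the (fun x => x ∈ C /\ pi x = z)).
  assert (He : definable_map e) by (unfold e; definability).
  assert (Espec : forall z, z ∈ a -> e z ∈ C /\ pi (e z) = z).
  { intros z Hz; apply (the_spec (fun x => x ∈ C /\ pi x = z)); [apply Honto, Hz |].
    intros x y [Hx E] [Hy E']; apply Hinj; congruence. }
  destruct (Hcf t (ap alpha t) Ht) as (c & (_ & _ & Hc) & Hthc).
  { apply (app_ap alpha Y); [apply Halpha | exact Ht | reflexivity]. }
  assert (Hca : ord_le c a).
  { apply Hc; [exact Ha |]; exists (lam a e); split; [split; [apply lam_fun, He |] |].
    - intros z y _ [Hz ->]%app_lam; [| exact He]; apply HC, Espec, Hz.
    - intros x Hx; destruct (Hcof x Hx) as (y & Hy & Hle).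
      exists (pi y), y; split; [auto | split; [| exact Hle]].
      apply app_lam; [exact He | split; [auto |]].
      destruct (Espec (pi y)) as [H1 H2]; auto. }
  destruct Htheta as (Oth & [Hne Hnoonto] & _); apply Hnoonto.
  assert (Hth : forall z, z ∈ theta -> z ∈ a).
  { intros z Hz; apply (ord_mem_le z c a Ha); [| exact Hca].
    destruct Hthc as [H | <-]; [| exact Hz].
    destruct Hca as [H' | ->]; [| eauto using ord_trans].
    exact (ord_trans c z theta (ord_mem a c Ha H') Hz H). }
  set (h := fun B : M => guard (u B ∈ C /\ pi (u B) ∈ theta) (pi (u B))).
  assert (Hh : definable_map h) by (unfold h, guard; definability).
  exists (lam PY h); split; [split; [apply lam_fun, Hh |] |].
  - intros B y _ [_ ->]%app_lam; [| exact Hh]; unfold h.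
    destruct (classic (u B ∈ C /\ pi (u B) ∈ theta)) as [H | H].
    + rewrite guard_true by exact H; apply H.
    + rewrite guard_false by exact H; apply empty_mem; assumption.
  - intros z Hz; destruct (Honto z (Hth z Hz)) as (x & Hx & <-).
    destruct (Hsurj x Hx) as (B & HB & ->).
    exists B; split; [exact HB |]; apply app_lam; [exact Hh | split; [exact HB |]].
    unfold h; rewrite guard_true; auto.
Qed.

Lemma alpha_nonempty t : t ∈ Y -> empty ∈ ap alpha t.
Proof.
  intro Ht; apply empty_mem; [apply alpha_ordinal, Ht |].
  destruct (small_set_bounded t empty (fun x => x)) as (x & Hx & _); auto.
  - definability.
  - intros y Hy; destruct (not_in_empty _ Hy).
  - intros y Hy; destruct (not_in_empty _ Hy).
  - exists x; exact Hx.
Qed.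

Definition Pi : M := prod Y (ap alpha).

Lemma in_Pi g : g ∈ Pi <-> is_fun g Y /\ forall t, t ∈ Y -> ap g t ∈ ap alpha t.
Proof. apply in_prod; definability. Qed.

Lemma Pi_fun g : g ∈ Pi -> is_fun g Y.
Proof. intros H%in_Pi; apply H. Qed.

Lemma Pi_ordinal g t : g ∈ Pi -> t ∈ Y -> is_ordinal (ap g t).
Proof.
  intros [_ Hg]%in_Pi Ht; exact (ord_mem _ _ (alpha_ordinal t Ht) (Hg t Ht)).
Qed.

(** At each [t] the values of the family form a small subset of [alpha_t], so the
    supremum of their successors stays below [alpha_t]. *)
Lemma family_bounded c : (forall B, B ∈ PY -> ap c B ∈ Pi) ->
  exists f, f ∈ Pi /\ forall B t, B ∈ PY -> t ∈ Y -> ap (ap c B) t ∈ ap f t.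
Proof.
  intro Hc.
  set (F := fun t => bigunion (image PY (fun B => succ (ap (ap c B) t)))).
  assert (HF : definable_map F) by (unfold F; definability).
  assert (EF : forall t y, y ∈ F t <-> exists B, B ∈ PY /\ ord_le y (ap (ap c B) t)).
  { intros t y; unfold F; rewrite in_bigunion; split.
    - intros (z & (B & HB & ->)%in_image & Hy%in_succ); [eauto | definability].
    - intros (B & HB & Hy); exists (succ (ap (ap c B) t)); split; [| apply in_succ, Hy].
      rewrite in_image by definability; eauto. }
  exists (lam Y F); split.
  - apply in_Pi; split; [apply lam_fun, HF |].
    intros t Ht; rewrite ap_lam by auto.
    assert (Oa := alpha_ordinal t Ht).
    assert (Hdef : definable_map (fun B => ap (ap c B) t)) by definability.
    destruct (small_set_bounded t (image PY (fun B => ap (ap c B) t)) (fun B => ap (ap c B) t))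
      as (x & Hx & Hbd); auto.
    + intros y (B & HB & ->)%in_image; [| exact Hdef]; apply (in_Pi (ap c B)); auto.
    + intros y (B & HB & ->)%in_image; [eauto | exact Hdef].
    + assert (Ox := ord_mem _ _ Oa Hx).
      apply (ord_le_mem (F t) x _ Oa); [| exact Hx].
      apply ord_le_subset; [| exact Ox |].
      * unfold F; apply ord_bigunion; intros z (B & HB & ->)%in_image; [| definability].
        apply ord_succ, Pi_ordinal; auto.
      * intros y (B & HB & Hy)%EF; apply (ord_le_mem y _ x Ox Hy), Hbd.
        apply in_image; eauto.
  - intros B t HB Ht; rewrite ap_lam by auto; apply EF; exists B; split; [auto | right; auto].
Qed.

(** ** Comparison modulo a filter *)

Definition ltset f g : M := sep Y (fun t => ap f t ∈ ap g t).

Definition lt (D : M) f g : Prop := ltset f g ∈ D.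

Lemma in_ltset f g t : t ∈ ltset f g <-> t ∈ Y /\ ap f t ∈ ap g t.
Proof. apply (in_sep t Y (fun t => ap f t ∈ ap g t)); definability. Qed.

Lemma ltset_PY f g : ltset f g ∈ PY.
Proof. apply HPY; intros t Ht; apply in_ltset in Ht; apply Ht. Qed.

Lemma filter_superset2 D A B C : is_filter D Y -> A ∈ D -> B ∈ D -> subset C Y ->
  (forall t, t ∈ A -> t ∈ B -> t ∈ C) -> C ∈ D.
Proof.
  intros (_ & _ & _ & Hup & Hmeet) HA HB HC H.
  apply (Hup (sep A (fun t => t ∈ B))); [| | exact HC].
  - apply (Hmeet A B); auto; intro t; rewrite in_sep by definability; reflexivity.
  - intros t [Ht Ht']%in_sep; [auto | definability].
Qed.

Lemma lt_trans D f g h : is_filter D Y -> h ∈ Pi -> lt D f g -> lt D g h -> lt D f h.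
Proof.
  intros HD Hh H1 H2; apply (filter_superset2 D _ _ _ HD H1 H2).
  - apply HPY, ltset_PY.
  - intros t [Ht Hfg]%in_ltset [_ Hgh]%in_ltset; apply in_ltset; split; [exact Ht |].
    exact (ord_trans _ _ _ (Pi_ordinal h t Hh Ht) Hfg Hgh).
Qed.

Lemma lt_irrefl D f : is_filter D Y -> ~ lt D f f.
Proof.
  intros (_ & _ & Hprop & _) H; apply (Hprop _ H).
  intros t [_ Ht]%in_ltset; exact (mem_irrefl _ Ht).
Qed.

Lemma lt_everywhere D f g : is_filter D Y -> (forall t, t ∈ Y -> ap f t ∈ ap g t) -> lt D f g.
Proof.
  intros HD H; unfold lt; replace (ltset f g) with Y; [apply HD |].
  apply set_ext; intro t; rewrite in_ltset; intuition.
Qed.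

Lemma lt_mod_iff D f g : is_fun f Y -> is_fun g Y -> (lt_mod Y D f g <-> lt D f g).
Proof.
  intros Hf Hg.
  assert (E : forall t, t ∈ ltset f g <->
    t ∈ Y /\ exists a b, app f t a /\ app g t b /\ a ∈ b).
  { intro t; rewrite in_ltset; split; intros [Ht H]; split; auto.
    - exists (ap f t), (ap g t); rewrite (app_ap f Y), (app_ap g Y) by auto; auto.
    - destruct H as (a & b & Ha & Hb & H).
      apply (app_ap f Y) in Ha; apply (app_ap g Y) in Hb; auto; congruence. }
  unfold lt; split.
  - intros (B & HB & EB); replace (ltset f g) with B; [exact HB |].
    apply set_ext; intro t; rewrite EB, E; reflexivity.
  - intro H; exists (ltset f g); auto.
Qed.

Definition eqset f g : M := sep Y (fun t => ap f t = ap g t).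

Lemma in_eqset f g t : t ∈ eqset f g <-> t ∈ Y /\ ap f t = ap g t.
Proof. apply (in_sep t Y (fun t => ap f t = ap g t)); definability. Qed.

Lemma lt_congruence D f f' g g' : is_filter D Y -> eqset f f' ∈ D -> eqset g g' ∈ D ->
  lt D f g -> lt D f' g'.
Proof.
  intros HD Hf Hg H.
  apply (filter_superset2 D (eqset f f') (sep (ltset f g) (fun t => t ∈ eqset g g'))); auto.
  - apply (filter_superset2 D (ltset f g) (eqset g g')); auto.
    + intros t [Ht _]%in_sep; [apply in_ltset in Ht; apply Ht | definability].
    + intros t H1 H2; apply in_sep; [definability | auto].
  - apply HPY, ltset_PY.
  - intros t [Ht E1]%in_eqset [H1%in_ltset H2%in_eqset]%in_sep; [| definability].
    apply in_ltset; destruct H1, H2; split; congruence.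
Qed.

Lemma eqset_refl D f : is_filter D Y -> eqset f f ∈ D.
Proof.
  intro HD; replace (eqset f f) with Y; [apply HD |].
  apply set_ext; intro t; rewrite in_eqset; intuition.
Qed.

(** The values of [f] that are not below [alpha] sit on a null set, and are
    replaced by [0]. *)
Lemma truncation D f : is_filter D Y -> lt D f alpha -> exists g, g ∈ Pi /\ eqset f g ∈ D.
Proof.
  intros HD Hf.
  set (F := fun t => guard (ap f t ∈ ap alpha t) (ap f t)).
  assert (HF : definable_map F) by (unfold F, guard; definability).
  exists (lam Y F); split.
  - apply in_Pi; split; [apply lam_fun, HF |].
    intros t Ht; rewrite ap_lam by auto; unfold F.
    destruct (classic (ap f t ∈ ap alpha t)) as [H | H].
    + rewrite guard_true; auto.
    + rewrite guard_false by exact H; apply alpha_nonempty, Ht.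
  - apply (filter_superset2 D _ _ _ HD Hf Hf).
    + intros t Ht; apply in_eqset in Ht; apply Ht.
    + intros t [Ht H]%in_ltset _; apply in_eqset; split; [exact Ht |].
      rewrite ap_lam by auto; unfold F; rewrite guard_true; auto.
Qed.

(** ** Scales *)

(** A witness for pseudo true cofinality whose levels consist of members of the
    product itself.  As [Pi] does not depend on [D], a scale modulo [D] remains
    one modulo every larger filter. *)
Definition scale D d F : Prop :=
  is_fun F d /\
  (forall i, i ∈ d -> nonempty (ap F i) /\ subset (ap F i) Pi) /\
  (forall i j f g, i ∈ j -> j ∈ d -> f ∈ ap F i -> g ∈ ap F j -> lt D f g) /\
  (forall f, f ∈ Pi -> exists i, i ∈ d /\ forall g, g ∈ ap F i -> lt D f g).

(** A witness becomes a scale when each level is replaced by all members of [Pi]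
    that agree modulo [D] with one of its members; truncation ensures that there
    are some. *)
Lemma pseudo_tcf_scale D d : is_filter D Y ->
  (has_pseudo_tcf Y alpha D d <-> is_limit d /\ exists F, scale D d F).
Proof.
  intro HD; assert (Fa : is_fun alpha Y) by apply Halpha.
  split; intros (Hd & F & HF); (split; [exact Hd |]).
  - destruct HF as (FF & Hval & Hinc & Hcof).
    assert (Happ : forall i, i ∈ d -> app F i (ap F i))
      by (intros i Hi; apply (app_ap F d); auto).
    assert (Oin : forall i j, i ∈ j -> j ∈ d -> i ∈ d)
      by (intros i j Hi Hj; exact (ord_trans d i j (proj1 Hd) Hi Hj)).
    assert (Ffun : forall i f, i ∈ d -> f ∈ ap F i -> is_fun f Y).
    { intros i f Hi Hf; apply (Hval i (ap F i) Hi (Happ i Hi)); exact Hf. }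
    set (G := fun i => sep Pi (fun g => exists f, f ∈ ap F i /\ eqset f g ∈ D)).
    assert (HG : definable_map G) by (unfold G, eqset; definability).
    assert (EG : forall i g, i ∈ d -> (g ∈ ap (lam d G) i <->
      g ∈ Pi /\ exists f, f ∈ ap F i /\ eqset f g ∈ D)).
    { intros i g Hi; rewrite ap_lam by auto; apply in_sep; unfold eqset; definability. }
    exists (lam d G); split; [apply lam_fun, HG | split; [| split]].
    + intros i Hi; destruct (Hval i (ap F i) Hi (Happ i Hi)) as [[f Hf] Hlt].
      split; [| intros g Hg; apply EG in Hg; [apply Hg | exact Hi]].
      destruct (truncation D f HD) as (g & Hg & Eg).
      * apply lt_mod_iff; [apply (Ffun i); auto | exact Fa | apply Hlt, Hf].
      * exists g; apply EG; eauto.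
    + intros i j f g Hij Hj (_ & f0 & Hf0 & Ef)%EG (_ & g0 & Hg0 & Eg)%EG; eauto.
      apply (lt_congruence D f0 f g0 g HD Ef Eg), lt_mod_iff; [eauto | eauto |].
      apply (Hinc i j (ap F i) (ap F j)); eauto.
    + intros f Hf; assert (Ff := Pi_fun f Hf).
      destruct (Hcof f) as (i & S & Hi & HS & Hlt).
      * split; [exact Ff |]; intros t a Ht Ha; apply (app_ap f Y) in Ha; auto; subst a.
        apply Pi_ordinal; auto.
      * apply lt_mod_iff; auto; apply lt_everywhere; auto; apply in_Pi, Hf.
      * apply (app_ap F d) in HS; auto; subst S.
        exists i; split; [exact Hi |]; intros g (_ & g0 & Hg0 & Eg)%EG; [| exact Hi].
        apply (lt_congruence D f f g0 g HD); [apply eqset_refl, HD | exact Eg |].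
        apply lt_mod_iff; eauto.
  - destruct HF as (FF & Hval & Hinc & Hcof).
    assert (Eapp : forall i S, i ∈ d -> (app F i S <-> S = ap F i))
      by (intros i S Hi; apply (app_ap F d); auto).
    assert (Oin : forall i j, i ∈ j -> j ∈ d -> i ∈ d)
      by (intros i j Hi Hj; exact (ord_trans d i j (proj1 Hd) Hi Hj)).
    assert (HPi : forall i f, i ∈ d -> f ∈ ap F i -> f ∈ Pi)
      by (intros i f Hi; apply (Hval i Hi)).
    exists F; split; [exact FF | split; [| split]].
    + intros i S Hi ->%Eapp; [| exact Hi]; split; [apply Hval, Hi |].
      intros f Hf%HPi; [| exact Hi]; assert (Ff := Pi_fun f Hf); split.
      * split; [exact Ff |]; intros t a Ht Ha; apply (app_ap f Y) in Ha; auto; subst a.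
        apply Pi_ordinal; auto.
      * apply lt_mod_iff; auto; apply lt_everywhere; auto; apply in_Pi, Hf.
    + intros i j S T f g Hij Hj ->%Eapp ->%Eapp Hf Hg; eauto.
      apply lt_mod_iff; [apply Pi_fun, (HPi i) | apply Pi_fun, (HPi j) |]; eauto.
    + intros f [Ff _] Hf%lt_mod_iff; auto.
      destruct (truncation D f HD Hf) as (f' & Hf' & E).
      destruct (Hcof f' Hf') as (i & Hi & Hlt).
      exists i, (ap F i); split; [exact Hi | split; [apply Eapp; auto |]].
      intros g Hg; apply lt_mod_iff; [exact Ff | apply Pi_fun, (HPi i); auto |].
      apply (lt_congruence D f' f g g HD); [| apply eqset_refl, HD | auto].
      replace (eqset f' f) with (eqset f f'); [exact E |].
      apply set_ext; intro t; rewrite !in_eqset; intuition.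
Qed.

Lemma scale_Pi D d F i f : scale D d F -> i ∈ d -> f ∈ ap F i -> f ∈ Pi.
Proof. intros (_ & Hval & _) Hi; apply (Hval i Hi). Qed.

Lemma scale_reindex D d F a s : is_ordinal d -> is_filter D Y -> scale D d F ->
  is_limit a -> definable_map s -> (forall i, i ∈ a -> s i ∈ d) ->
  (forall i j, i ∈ j -> j ∈ a -> s i ∈ s j) ->
  (forall x, x ∈ d -> exists i, i ∈ a /\ x ∈ s i) ->
  scale D a (lam a (fun i => ap F (s i))).
Proof.
  intros Od HD HF La Hs Hsd Hmono Hcof.
  assert (E : forall i, i ∈ a -> ap (lam a (fun i => ap F (s i))) i = ap F (s i))
    by (intros i Hi; rewrite ap_lam; [reflexivity | definability | exact Hi]).
  assert (HPi := fun i f => scale_Pi D d F i f HF).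
  destruct HF as (FF & Hval & Hinc & Hsup).
  split; [apply lam_fun; definability | split; [| split]].
  - intros i Hi; rewrite E by exact Hi; auto.
  - intros i j f g Hij Hj; rewrite E by (exact (ord_trans a i j (proj1 La) Hij Hj)).
    rewrite E by exact Hj; apply Hinc; auto.
  - intros f Hf; destruct (Hsup f Hf) as (x & Hx & Hlt).
    destruct (Hcof x Hx) as (i & Hi & Hxi).
    exists i; split; [exact Hi |]; rewrite E by exact Hi; intros g Hg.
    destruct (proj1 (Hval x Hx)) as [g0 Hg0].
    apply (lt_trans D f g0 g HD); eauto.
Qed.

(** Choose a member of level [b B] for each [B].  A pointwise bound [f] of these
    functions is below some level [i], and then no [b B] can exceed [i], for a
    member of level [i] would be below the chosen one, hence below [f]. *)
Lemma scale_index_bounded D d F b : is_filter D Y -> is_limit d -> scale D d F ->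
  (forall B, B ∈ PY -> ap b B ∈ d) -> exists i, i ∈ d /\ forall B, B ∈ PY -> ap b B ∈ i.
Proof.
  intros HD Ld HF Hb; assert (HPi := fun i f => scale_Pi D d F i f HF).
  destruct HF as (FF & Hval & Hinc & Hsup); assert (Od := proj1 Ld).
  destruct (choice Pi (fun B g => g ∈ ap F (ap b B))) as (c & Hc).
  - definability.
  - intros B HB; destruct (proj1 (Hval _ (Hb B HB))) as [g Hg]; eauto.
  - destruct (family_bounded c) as (f & Hf & Hcf'); [intros B HB; apply Hc, HB |].
    destruct (Hsup f Hf) as (i & Hi & Hlt).
    exists (succ i); split; [apply limit_succ; auto |].
    intros B HB; apply in_succ; destruct (Hc B HB) as [HcPi HcF].
    destruct (ord_trichotomy (ap b B) i) as [H | [H | H]]; auto.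
    + exact (ord_mem d _ Od (Hb B HB)).
    + exact (ord_mem d _ Od Hi).
    + destruct (proj1 (Hval i Hi)) as [g Hg].
      destruct (lt_irrefl D g HD).
      apply (lt_trans D g (ap c B) g HD); eauto.
      apply (lt_trans D (ap c B) f g HD); eauto.
      apply lt_everywhere; auto.
Qed.

(** Let [f] map some [b < d] cofinally into [d], and thin with
    [K i x = max(x, f i)].  The levels with index [s i] form a scale, so by
    minimality of [d] the thinned sequence still has length [d].  In particular
    [s b] is defined; it exceeds every [f i], against cofinality. *)
Lemma ps_tcf_regular D d : is_filter D Y -> is_ps_tcf Y alpha D d -> is_regular_cardinal d.
Proof.
  intros HD (Od & Htcf & Hmin).
  destruct (proj1 (pseudo_tcf_scale D d HD) Htcf) as (Ld & F & HF).
  assert (Hcofd : forall b f, is_ordinal b -> maps_to f b d ->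
    (forall x, x ∈ d -> exists i y, i ∈ b /\ app f i y /\ ord_le x y) -> ord_le d b).
  { intros b f Ob [Ff Hfd] Hcof; apply ord_not_mem; auto; intro Hbd.
    set (K := fun i x => bigunion (upair x (guard (i ∈ b) (ap f i)))).
    assert (HK : definable_map2 K) by (unfold K, guard; definability).
    assert (Hg : forall i, guard (i ∈ b) (ap f i) ∈ d).
    { intro i; destruct (classic (i ∈ b)) as [Hi | Hi].
      - rewrite guard_true by exact Hi; apply (Hfd i); [| apply (app_ap f b)]; auto.
      - rewrite guard_false by exact Hi; apply empty_mem; [exact Od | apply Ld]. }
    destruct (thinning d K Ld HK) as (a & s & La & Had & Hs & Hsd & Hmono & Hsup).
    { intros i x _ Hx; split; [apply ord_max_mem; auto |].
      apply ord_max_ub; apply (ord_mem d); auto. }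
    assert (Hle : forall i, i ∈ a -> ord_le (s i) (K i (s i)) /\
                                   ord_le (guard (i ∈ b) (ap f i)) (K i (s i))).
    { intros i Hi; apply ord_max_ub; apply (ord_mem d); auto. }
    assert (E : d = a).
    { apply ord_le_antisym; [| exact Had]; apply Hmin; [apply La |].
      apply pseudo_tcf_scale; [exact HD | split; [exact La |]].
      exists (lam a (fun i => ap F (s i))); apply (scale_reindex D d); auto.
      intros i j Hij Hj; apply (ord_le_mem _ (K i (s i))); auto.
      - apply (ord_mem d); auto.
      - apply Hle; exact (ord_trans a i j (proj1 La) Hij Hj). }
    subst a; destruct (Hcof (s b) (Hsd b Hbd)) as (i & y & Hi & Hy & Hby).
    apply (app_ap f b) in Hy; auto; subst y.
    assert (Hid : i ∈ d) by (eauto using ord_trans).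
    assert (Osb : is_ordinal (s b)) by (apply (ord_mem d); auto).
    apply (mem_irrefl (s b)), (ord_le_mem _ (ap f i) _ Osb Hby).
    apply (ord_le_mem _ (K i (s i)) _ Osb); [| auto].
    destruct (Hle i Hid) as [_ H]; rewrite guard_true in H by exact Hi; exact H. }
  split; [split; [exact Od |] | split; [exact Ld |]].
  - intros b Hb (f & [Hmap Honto] & _).
    assert (Ob := ord_mem d b Od Hb).
    assert (Hdb : ord_le d b).
    { apply (Hcofd b f Ob Hmap); intros x Hx; destruct (Honto x Hx) as (i & Hi & Hix).
      exists i, x; repeat split; auto; right; reflexivity. }
    apply (mem_irrefl d); eapply ord_le_mem; eauto.
  - split; [exact Od | split].
    + exists (lam d (fun x => x)); split; [split; [apply lam_fun; definability |] |].
      * intros x y Hx [_ ->]%app_lam; [exact Hx | definability].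
      * intros x Hx; exists x, x; split; [exact Hx | split; [| right; reflexivity]].
        apply app_lam; [definability | auto].
    + intros b Ob (f & Hmap & Hcof); exact (Hcofd b f Ob Hmap Hcof).
Qed.

(** * Intersections of filters *)

(** The hypothesis on [D] says that it contains the intersection of the filters
    [DB B].  A level of the new scale has to be a set of functions with a common
    bound, modulo all the filters at once; this is why it is cut off at [h b]. *)
Lemma scale_intersection d DB SB D : is_limit d ->
  (forall B, B ∈ PY -> is_filter (ap DB B) Y) ->
  (forall B, B ∈ PY -> scale (ap DB B) d (ap SB B)) ->
  (forall A, A ∈ PY -> (forall B, B ∈ PY -> A ∈ ap DB B) -> A ∈ D) ->
  exists a F, is_limit a /\ ord_le a d /\ scale D a F.
Proof.
  intros Ld HDB HSB HD; assert (Od := proj1 Ld).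
  set (above := fun f b => forall B i g, B ∈ PY -> i ∈ b -> g ∈ ap (ap SB B) i ->
                                lt (ap DB B) g f).
  set (below := fun f b => forall B g, B ∈ PY -> g ∈ ap (ap SB B) b -> lt (ap DB B) f g).
  assert (Habove : definable_rel above) by (unfold above, lt, ltset; definability).
  assert (Hbelow : definable_rel below) by (unfold below, lt, ltset; definability).
  assert (HPi : forall B i g, B ∈ PY -> i ∈ d -> g ∈ ap (ap SB B) i -> g ∈ Pi)
    by (intros B i g HB; apply (scale_Pi (ap DB B) d (ap SB B)); auto).
  assert (Hne : forall B i, B ∈ PY -> i ∈ d -> exists g, g ∈ ap (ap SB B) i)
    by (intros B i HB Hi; apply (HSB B HB), Hi).
  assert (Hinc : forall B i j f g, B ∈ PY -> i ∈ j -> j ∈ d ->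
    f ∈ ap (ap SB B) i -> g ∈ ap (ap SB B) j -> lt (ap DB B) f g)
    by (intros B i j f g HB; apply (HSB B HB)).
  assert (Hbelow_mono : forall f i j, i ∈ j -> j ∈ d -> below f i -> below f j).
  { intros f i j Hij Hj Hf B g HB Hg.
    destruct (Hne B i HB (ord_trans d i j Od Hij Hj)) as [g0 Hg0].
    apply (lt_trans _ f g0 g (HDB B HB)); eauto. }
  assert (Hbelow_ex : forall f, f ∈ Pi -> exists i, i ∈ d /\ below f i).
  { intros f Hf.
    destruct (choice d (fun B i => forall g, g ∈ ap (ap SB B) i -> lt (ap DB B) f g))
      as (b & Hb); [unfold lt, ltset; definability | |].
    - intros B HB; apply (HSB B HB), Hf.
    (* Any one of the scales bounds the indices; the one for [Y] is used. *)
    - destruct (scale_index_bounded (ap DB Y) d (ap SB Y) b) as (i & Hi & Hbi);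
        auto using top_in_PY; [intros B HB; apply Hb, HB |].
      exists i; split; [exact Hi |]; intros B g HB Hg.
      destruct (Hb B HB) as [Hbd Hlt]; destruct (Hne B _ HB Hbd) as [g0 Hg0].
      apply (lt_trans _ f g0 g (HDB B HB)); eauto. }
  assert (Habove_ex : forall b, b ∈ d -> exists f, f ∈ Pi /\ above f b).
  { intros b Hb; destruct (choice Pi (fun B g => g ∈ ap (ap SB B) b)) as (c & Hc).
    - definability.
    - intros B HB; destruct (Hne B b HB Hb) as [g Hg]; eauto.
    - destruct (family_bounded c) as (f & Hf & Hcf'); [intros B HB; apply Hc, HB |].
      exists f; split; [exact Hf |]; intros B i g HB Hi Hg.
      destruct (Hc B HB) as [_ HcB].
      apply (lt_trans _ g (ap c B) f (HDB B HB)); eauto.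
      apply lt_everywhere; auto. }
  set (good := fun b j => j ∈ d /\ b ∈ j /\ exists f, f ∈ Pi /\ above f b /\ below f j).
  set (h := fun b => the (is_least_ordinal (good b))).
  assert (Hh : definable_map h) by (unfold h, is_least_ordinal, good; definability).
  assert (h_good : forall b, b ∈ d -> good b (h b)).
  { intros b Hb; destruct (Habove_ex b Hb) as (f & Hf & Hfb).
    destruct (Hbelow_ex f Hf) as (i & Hi & Hfi).
    set (j := succ (bigunion (upair b i))).
    assert (Hj : j ∈ d) by (apply limit_succ, ord_max_mem; auto).
    assert (Oj := ord_mem d j Od Hj).
    destruct (ord_max_ub b i (ord_mem d b Od Hb) (ord_mem d i Od Hi)) as [Hbm Him].
    assert (Hm : bigunion (upair b i) ∈ j) by (apply in_succ; auto).
    apply (least_ordinal_exists (good b) j).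
    - unfold good; definability.
    - exact Oj.
    - split; [exact Hj | split; [exact (ord_le_mem _ _ j Oj Hbm Hm) |]].
      exists f; split; [exact Hf | split; [exact Hfb |]].
      exact (Hbelow_mono f i j (ord_le_mem _ _ j Oj Him Hm) Hj Hfi). }
  destruct (thinning d (fun _ b => h b) Ld) as (a & s & La & Had & Hs & Hsd & Hmono & Hcof).
  { definability. }
  { intros _ b _ Hb; destruct (h_good b Hb) as (H1 & H2 & _); split; [| left]; assumption. }
  set (G := fun i => sep Pi (fun f => above f (s i) /\ below f (h (s i)))).
  assert (HG : definable_map G) by (unfold G; definability).
  assert (EG : forall i f, i ∈ a -> (f ∈ ap (lam a G) i <->
    f ∈ Pi /\ above f (s i) /\ below f (h (s i)))).
  { intros i f Hi; rewrite ap_lam by auto; unfold G; rewrite in_sep by definability; reflexivity. }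
  assert (Hsep : forall f g j b, g ∈ Pi -> b ∈ d -> below f b -> b ∈ j -> above g j -> lt D f g).
  { intros f g j b Hg Hb Hfb Hbj Hgj; apply HD; [apply ltset_PY |].
    intros B HB; destruct (Hne B b HB Hb) as [g0 Hg0].
    apply (lt_trans _ f g0 g (HDB B HB)); eauto. }
  exists a, (lam a G); split; [exact La | split; [exact Had |]].
  split; [apply lam_fun, HG | split; [| split]].
  - intros i Hi; split; [| intros f Hf; apply EG in Hf; [apply Hf | exact Hi]].
    destruct (h_good (s i) (Hsd i Hi)) as (_ & _ & f & Hf & H1 & H2).
    exists f; apply EG; auto.
  - intros i j f g Hij Hj Hf Hg.
    assert (Hi := ord_trans a i j (proj1 La) Hij Hj).
    apply EG in Hf, Hg; auto; destruct Hf as (_ & _ & Hf), Hg as (HgPi & Hg & _).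
    apply (Hsep f g (s j) (h (s i))); auto.
    apply h_good; auto.
  - intros f Hf; destruct (Hbelow_ex f Hf) as (b & Hb & Hfb).
    destruct (Hcof b Hb) as (i & Hi & Hbi); exists i; split; [exact Hi |].
    intros g Hg; apply EG in Hg; auto; destruct Hg as (HgPi & Hg & _).
    exact (Hsep f g (s i) b HgPi Hb Hfb Hbi Hg).
Qed.

(** Immediate for scales; truncation is what makes it true for functions that are
    below [alpha] only modulo the larger filter. *)
Lemma pseudo_tcf_mono D D' d : is_filter D Y -> is_filter D' Y -> subset D D' ->
  has_pseudo_tcf Y alpha D d -> has_pseudo_tcf Y alpha D' d.
Proof.
  intros HD HD' Hsub; rewrite !pseudo_tcf_scale by assumption.
  intros (Ld & F & FF & Hval & Hinc & Hsup).
  split; [exact Ld |]; exists F; split; [exact FF | split; [exact Hval | split]].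
  - intros i j f g Hij Hj Hf Hg; apply Hsub; exact (Hinc i j f g Hij Hj Hf Hg).
  - intros f Hf; destruct (Hsup f Hf) as (i & Hi & Hlt).
    exists i; split; [exact Hi |]; intros g Hg; apply Hsub; exact (Hlt g Hg).
Qed.

(** The intersection of all realizing filters is already the intersection of
    filters indexed by the power set of [Y]: one that omits [B], for each [B] that
    is omitted by some. *)
Lemma least_realizing_filter_exists d : in_ps_pcf_aleph1_comp Y alpha d ->
  is_regular_cardinal d /\
  exists D : M,
    is_aleph1_complete_filter D Y /\
    is_ps_tcf Y alpha D d /\
    forall D' : M,
      is_aleph1_complete_filter D' Y -> is_ps_tcf Y alpha D' d -> subset D D'.
Proof.
  intros (D0 & HD0 & Hd0); split; [exact (ps_tcf_regular D0 d (proj1 HD0) Hd0) |].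
  set (realizes := fun D => is_aleph1_complete_filter D Y /\ is_ps_tcf Y alpha D d).
  assert (Hrealizes : definable_pred realizes).
  { unfold realizes, is_aleph1_complete_filter, is_filter, is_omega, is_ps_tcf,
      is_least_ordinal, has_pseudo_tcf, lt_mod, ord_fun; definability. }
  set (D := sep PY (fun B => forall D', realizes D' -> B ∈ D')).
  assert (in_D : forall B, B ∈ D <-> B ∈ PY /\ forall D', realizes D' -> B ∈ D')
    by (intro B; unfold D; rewrite in_sep by definability; reflexivity).
  assert (R0 : realizes D0) by (split; assumption).
  assert (HD : is_filter D Y).
  { split; [| split; [| split; [| split]]].
    - intros A [HA _]%in_D; apply HPY, HA.
    - apply in_D; split; [apply top_in_PY |]; intros D' [HD' _]; apply HD'.
    - intros A [_ HA]%in_D; apply (proj1 HD0), HA, R0.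
    - intros A B [_ HA]%in_D HAB HBY; apply in_D; split; [apply HPY, HBY |].
      intros D' R; assert (HAD := HA D' R); destruct R as [[(_ & _ & _ & Hup & _) _] _].
      exact (Hup A B HAD HAB HBY).
    - intros A B C [HAY HA]%in_D [_ HB]%in_D HC; apply in_D; split.
      + apply HPY; intros t Ht; apply HC in Ht; apply HPY in HAY; apply HAY, Ht.
      + intros D' R; assert (HAD := HA D' R); assert (HBD := HB D' R).
        destruct R as [[(_ & _ & _ & _ & Hmeet) _] _]; exact (Hmeet A B C HAD HBD HC). }
  assert (HDc : is_aleph1_complete_filter D Y).
  { split; [exact HD |]; intros w q B Hw [Hq Hqv] HB; apply in_D; split.
    - apply HPY; intros t Ht; apply HB in Ht; apply Ht.
    - intros D' R; assert (R' := R); destruct R' as [[_ Hc] _]; apply (Hc w q B Hw); [| exact HB].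
      split; [exact Hq |]; intros n A Hn HA; apply (in_D A); [exact (Hqv n A Hn HA) | exact R]. }
  assert (Hmin : forall D', is_aleph1_complete_filter D' Y -> is_ps_tcf Y alpha D' d -> subset D D').
  { intros D' H1 H2 B [_ HB]%in_D; apply HB; split; assumption. }
  exists D; split; [exact HDc | split; [| exact Hmin]].
  assert (HDD0 : forall c, has_pseudo_tcf Y alpha D c -> has_pseudo_tcf Y alpha D0 c)
    by (intro c; apply pseudo_tcf_mono; [exact HD | apply HD0 | apply Hmin; apply R0]).
  destruct Hd0 as (Od & Htcf0 & Hleast).
  destruct (proj1 (pseudo_tcf_scale D0 d (proj1 HD0)) Htcf0) as (Ld & _).
  destruct (choice (power PY) (fun B D' => realizes D' /\ (B ∈ D' -> B ∈ D))) as (DB & HDB).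
  { definability. }
  { (* For [B] in [D] any realizing filter will do, and [D0] is one. *)
    assert (Hpow : forall D', realizes D' -> D' ∈ power PY).
    { intros D' [[HF _] _]; apply in_power; intros A HA; apply HPY, HF, HA. }
    intros B HB; destruct (classic (B ∈ D)) as [H | H]; [exists D0; auto |].
    apply NNPP; intro Hno; apply H, in_D; split; [exact HB |].
    intros D' R; apply NNPP; intro HBD'; apply Hno; exists D'.
    split; [apply Hpow, R | split; [exact R | contradiction]]. }
  destruct (choice (prod d (fun _ => power Pi)) (fun B F => scale (ap DB B) d F)) as (SB & HSB).
  { unfold scale, lt, ltset; definability. }
  { intros B HB; destruct (HDB B HB) as (_ & [[HF _] (_ & Ht & _)] & _).
    apply (pseudo_tcf_scale (ap DB B) d HF) in Ht; destruct Ht as (_ & F & HS).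
    exists F; split; [| exact HS]; apply in_prod; [definability |].
    split; [apply HS |]; intros i Hi; apply in_power, HS, Hi. }
  destruct (scale_intersection d DB SB D Ld) as (a & F & La & Had & HF).
  { intros B HB; apply (HDB B HB). }
  { intros B HB; apply (HSB B HB). }
  { intros A HA Hall; apply (HDB A HA), Hall, HA. }
  assert (HDa : has_pseudo_tcf Y alpha D a)
    by (apply pseudo_tcf_scale; [exact HD | split; [exact La | exists F; exact HF]]).
  assert (E : d = a) by (apply ord_le_antisym; [apply Hleast; [apply La | auto] | exact Had]).
  rewrite <- E in HDa; split; [exact Od | split; [exact HDa |]].
  intros c Oc Hc; apply Hleast; auto.
Qed.

End Model.

Theorem theorem5p19
  (M : SetStructure) (HZF : ZF M) (HDC : DC M)
  (Y PY : M) (HPY : is_powerset PY Y) (HAC : AC_on PY)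
  (alpha : M) (Halpha : ord_fun alpha Y)
  (theta : M) (Htheta : is_theta PY theta)
  (Hcf : forall t a : M, t ∈ Y -> app alpha t a ->
           exists c : M, is_cf a c /\ ord_le theta c)
  (d : M) (Hd : in_ps_pcf_aleph1_comp Y alpha d) :
  is_regular_cardinal d /\
  exists D : M,
    is_aleph1_complete_filter D Y /\
    is_ps_tcf Y alpha D d /\
    forall D' : M,
      is_aleph1_complete_filter D' Y -> is_ps_tcf Y alpha D' d -> subset D D'.
Proof.
  exact (least_realizing_filter_exists HZF Y PY HPY HAC alpha Halpha theta Htheta Hcf d Hd).
Qed.
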